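(* Suppose that $K$ is closed at infinity. If $f>0$ on $K$ and $f$ is positive at infinity on $K$, then there exist $\sigma_\ell\in\mathrm{QM}[\{x_0\}\cup\{1-u_i^2\}_{u_i\in\mathbf{u}(\ell)}\cup\{\tilde g_j\}_{j\in J_\ell},\mathbf{u}(\ell)]$ for each $\ell\in\{1,\dots,q\}$ and $\tau_{\ell,j}\in\mathbb{R}[\mathbf{u}(\ell)]$ for each $\ell\in\{1,\dots,q\}$ and $j\in I_\ell$ such that $$\tilde f=\sum_{\ell=1}^q\left(\sigma_\ell+\sum_{j\in I_\ell}\tau_{\ell,j}h'_j\right).$$
   Context: Polynomial optimization problem (POP). Let $\mathbf{x}=(x_1,\dots,x_n)$, $f,g_1,\dots,g_m\in\mathbb{R}[\mathbf{x}]$, $K=\{\mathbf{x}\in\mathbb{R}^n : g_j(\mathbf{x})\ge 0,\ j=1,\dots,m\}$, with $\inf_K f>-\infty$ assumed throughout. Put $d=\deg(f)$. Homogenization. Let $\tilde{\mathbf{x}}=(x_0,x_1,\dots,x_n)$. For $q\in\mathbb{R}[\mathbf{x}]$, $\tilde q(\tilde{\mathbf{x}})=x_0^{\deg(q)}q(\mathbf{x}/x_0)$ and $q^{(\infty)}$ is the homogeneous part of $q$ of degree $\deg(q)$. Define $\widetilde K=\{\tilde{\mathbf{x}}\in\mathbb{R}^{n+1} : \tilde g_j(\tilde{\mathbf{x}})\ge 0\ (j=1,\dots,m),\ x_0\ge 0,\ \|\tilde{\mathbf{x}}\|^2=1\}$. $K$ is closed at infinity if $\widetilde K$ equals the closure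 of $\widetilde K\cap\{x_0>0\}$. Let $K^{(\infty)}=\{\mathbf{x}\in\mathbb{R}^n : g_j^{(\infty)}(\mathbf{x})\ge0\ (j=1,\dots,m),\ \|\mathbf{x}\|^2=1\}$; $f$ is positive (definite) at infinity on $K$ if $f^{(\infty)}>0$ on $K^{(\infty)}$. Correlative sparsity. The POP $\inf_K f$ is assumed to have a correlative sparsity pattern $(\mathbf{x}(1),\dots,\mathbf{x}(p))$: $\mathbf{x}(\ell)\subseteq\{x_1,\dots,x_n\}$, $\bigcup_\ell\mathbf{x}(\ell)=\{x_1,\dots,x_n\}$, $f=\sum_{\ell=1}^p f_\ell$ with $f_\ell\in\mathbb{R}[\mathbf{x}(\ell)]$, and $\{1,\dots,m\}$ can be partitioned into $p$ (possibly empty) sets such that each $g_j$ with $j$ in the $\ell$-th set lies in $\mathbb{R}[\mathbf{x}(\ell)]$. Let $p_i$ be the number of $\ell$ with $x_i\in\mathbf{x}(\ell)$. Reformulation. Let $\mathbf{w}=(w_1,\dots,w_p)$ be auxiliary variables and $$h'_\ell=\sum_{x_i\in\mathbf{x}(\ell)}\tfrac1{p_i}x_i^2+\tfrac1p x_0^2+w_\ell^2-1\ (\ell=1,\dots,p),\qquad h'_{p+1}=\|\mathbf{w}\|^2-p+1.$$ Let $\widetilde K_s^2$ be the set of $(\tilde{\mathbf{x}},\mathbf{w})\in\mathbb{R}^{n+1+p}$ with $x_0\ge0$, $\tilde g_j(\tilde{\mathbf{x}})\ge0$ $(j=1,\dots,m)$, $h'_\ell=0$ $(\ell=1,\dots,p+1)$,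 $1-x_i^2\ge0$ $(i=0,\dots,n)$, $1-w_\ell^2\ge0$ $(\ell=1,\dots,p)$. The reformulation is: maximize $\gamma$ subject to $\tilde f-\gamma x_0^d\ge0$ on $\widetilde K_s^2$. Cliques. Let $\mathbf{u}=(\tilde{\mathbf{x}},\mathbf{w})$. The csp graph of the reformulation has the variables in $\mathbf{u}$ as vertices, two variables being adjacent if they occur together in a monomial of $\tilde f-\gamma x_0^d$ or both occur in the same constraint polynomial defining $\widetilde K_s^2$. Let $\mathbf{u}(1),\dots,\mathbf{u}(q)$ be the list of maximal cliques of some chordal extension (a chordal graph on the same vertices containing all edges) of this graph. Let $\{J_1,\dots,J_q\}$ be a partition of $\{1,\dots,m\}$ (parts may be empty) with $\tilde g_j\in\mathbb{R}[\mathbf{u}(\ell)]$ for $j\in J_\ell$, and $\{I_1,\dots,I_q\}$ a partition of $\{1,\dots,p+1\}$ with $h'_j\in\mathbb{R}[\mathbf{u}(\ell)]$ for $j\in I_\ell$. For a set of variables $V$ and finite $G\subset\mathbb{R}[V]$, $\Sigma[V]$ is the set of sums of squares in $\mathbb{R}[V]$ and $\mathrm{QM}[G,V]=\Sigma[V]+\sum_{g\in G}g\cdot\Sigma[V]$. *)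

(* Defs.v *)
Set Warnings "-notation-overridden,-ambiguous-paths,-notation-incompatible-prefix".
From mathcomp Require Import all_boot all_order all_algebra.
From mathcomp Require Import mpoly.
From mathcomp Require Import classical_sets reals constructive_ereal ereal.
From mathcomp Require Import topology normedtype.

Set Implicit Arguments.
Unset Strict Implicit.
Unset Printing Implicit Defensive.

Import Order.TTheory GRing.Theory Num.Theory.
Import numFieldNormedType.Exports.

Local Open Scope classical_set_scope.
Local Open Scope ring_scope.

Section Polynomials.
Context {R : realType}.

Definition eval_at (n : nat) (q : {mpoly R[n]}) (y : 'rV[R]_n) : R :=
  q.@[fun i => y ord0 i].

(* The zero polynomial gets degree 0. *)
Definition mdegree (n : nat) (q : {mpoly R[n]}) : nat := (msize q).-1.

(* Exponent of [x_0 ^ (d - |mm|) * x ^ mm]; index [ord0] stands for x_0 and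
   [lift ord0 i] for the i-th original variable. *)
Definition homogenize_mnm (n d : nat) (mm : 'X_{1..n}) : 'X_{1..n.+1} :=
  [multinom (if unlift ord0 i is Some j then mm j else (d - mdeg mm)%N)
    | i < n.+1].

(* x_0 ^ deg(q) * q (x / x_0), expanded monomial by monomial. *)
Definition homogenize (n : nat) (q : {mpoly R[n]}) : {mpoly R[n.+1]} :=
  \sum_(mm <- msupp q) q@_mm *: 'X_[homogenize_mnm (mdegree q) mm].

Definition top_part (n : nat) (q : {mpoly R[n]}) : {mpoly R[n]} :=
  pihomog mdeg (mdegree q) q.

Definition mvars (n : nat) (q : {mpoly R[n]}) : {set 'I_n} :=
  [set i : 'I_n | has (fun mm : 'X_{1..n} => mm i != 0%N) (msupp q)]%SET.

(* q belongs to R[V], where V is a set of variables given by their indices. *)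
Definition polyIn (n : nat) (V : {set 'I_n}) (q : {mpoly R[n]}) : Prop :=
  mvars q \subset V.

Definition sos (n : nat) (V : {set 'I_n}) (q : {mpoly R[n]}) : Prop :=
  exists s : seq {mpoly R[n]},
    (forall r, r \in s -> polyIn V r) /\ q = \sum_(r <- s) r ^+ 2.

(* The finite set G is given by an enumeration; repetitions in it do not
   change the quadratic module. *)
Definition QM (n : nat) (G : seq {mpoly R[n]}) (V : {set 'I_n})
    (q : {mpoly R[n]}) : Prop :=
  exists (s0 : {mpoly R[n]}) (s : {mpoly R[n]} -> {mpoly R[n]}),
    [/\ sos V s0,
        forall h, h \in G -> sos V (s h)
      & q = s0 + \sum_(h <- G) h * s h].

End Polynomials.

(* A partition of a finite type into possibly empty parts. *)
Definition family_partition (q : nat) (T : finType) (A : 'I_q -> {set T}) :=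
  (\bigcup_(l < q) A l = [set: T])%SET /\
  (forall k l a, a \in A k -> a \in A l -> k = l).

Section Graphs.
Context {T : finType}.

Definition simple_graph (e : rel T) : Prop := ssrbool.symmetric e /\ irreflexive e.

(* Every cycle of length at least 4 has a chord. *)
Definition chordal (e : rel T) : Prop :=
  forall c : seq T, uniq c -> (4 <= size c)%N -> cycle e c ->
    exists a b, [/\ a \in c, b \in c, e a b, b != next c a & a != next c b].

Definition chordal_extension (adj : T -> T -> Prop) (e : rel T) : Prop :=
  [/\ simple_graph e, chordal e & forall a b, adj a b -> e a b].

Definition clique (e : rel T) (S : {set T}) : bool :=
  [forall a in S, forall b in S, (a != b) ==> e a b].

Definition maximal_cliques (e : rel T) (q : nat) (u : 'I_q -> {set T}) : Prop :=
  injective u /\ (forall S, maxset (clique e) S <-> exists l, u l = S).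

End Graphs.

Section POP.
Context {R : realType} {n m p : nat}.
Variables (f : {mpoly R[n]}) (g : 'I_m -> {mpoly R[n]}).
Variable (x : 'I_p -> {set 'I_n}).

Definition feasible : set 'rV[R]_n :=
  [set y | forall j, 0 <= eval_at (g j) y].

(* The norms below are Euclidean, whereas `|y| on 'rV is the sup norm. *)
Definition feasible_hom : set 'rV[R]_n.+1 :=
  [set y | [/\ forall j, 0 <= eval_at (homogenize (g j)) y,
               0 <= y ord0 ord0
             & \sum_i y ord0 i ^+ 2 = 1]].

Definition closed_at_infinity : Prop :=
  feasible_hom =
  closure (feasible_hom `&` [set y : 'rV[R]_n.+1 | 0 < y ord0 ord0]).

Definition feasible_inf : set 'rV[R]_n :=
  [set y | (forall j, 0 <= eval_at (top_part (g j)) y) /\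
           \sum_i y ord0 i ^+ 2 = 1].

Definition positive_at_infinity : Prop :=
  forall y, feasible_inf y -> 0 < eval_at (top_part f) y.

Definition correlative_sparsity : Prop :=
  [/\ (\bigcup_(l < p) x l = [set: 'I_n])%SET,
      exists fl : 'I_p -> {mpoly R[n]},
        (forall l, polyIn (x l) (fl l)) /\ f = \sum_(l < p) fl l
    & exists P : 'I_p -> {set 'I_m},
        family_partition P /\ (forall l j, j \in P l -> polyIn (x l) (g j))].

(* The variables u = (x_0, x_1, ..., x_n, w_1, ..., w_p) are indexed by
   'I_(n.+1 + p), the first n.+1 of them being x_0, ..., x_n. *)
Definition x0_var : {mpoly R[n.+1 + p]} := 'X_(lshift p ord0).
Definition x_var (i : 'I_n) : {mpoly R[n.+1 + p]} :=
  'X_(lshift p (lift ord0 i)).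
Definition w_var (l : 'I_p) : {mpoly R[n.+1 + p]} := 'X_(rshift n.+1 l).

(* The homogenization, seen as a polynomial in all the variables u. *)
Definition tilde (q : {mpoly R[n]}) : {mpoly R[n.+1 + p]} :=
  homogenize q \mPo [tuple 'X_(lshift p i) | i < n.+1].

Definition multiplicity (i : 'I_n) : nat := #|[set l | i \in x l]%SET|.

(* The index [ord_max] gives h'_(p+1), the other ones h'_1, ..., h'_p. *)
Definition hprime (j : 'I_p.+1) : {mpoly R[n.+1 + p]} :=
  if unlift ord_max j is Some l then
    \sum_(i in x l) (multiplicity i)%:R^-1 *: x_var i ^+ 2
      + p%:R^-1 *: x0_var ^+ 2 + w_var l ^+ 2 - 1
  else \sum_(l < p) w_var l ^+ 2 - p%:R + 1.

Definition ball_poly (i : 'I_(n.+1 + p)) : {mpoly R[n.+1 + p]} :=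
  1 - 'X_i ^+ 2.

(* All polynomials, from inequalities and equations alike, that define the
   feasible set of the reformulation. *)
Definition reformulation_constraints : seq {mpoly R[n.+1 + p]} :=
  x0_var :: [seq tilde (g j) | j <- enum 'I_m]
    ++ [seq hprime j | j <- enum 'I_p.+1]
    ++ [seq ball_poly i | i <- enum 'I_(n.+1 + p)].

(* The parameter gamma only affects a power of x_0, so that the choice of its
   value has no influence on the edges. *)
Definition csp_adj (a b : 'I_(n.+1 + p)) : Prop :=
  a != b /\
  ((exists gamma : R,
      exists2 mm, mm \in msupp (tilde f - gamma *: x0_var ^+ mdegree f)
                & (mm a != 0%N) && (mm b != 0%N))
   \/ (exists2 c, c \in reformulation_constraints
                & (a \in mvars c) && (b \in mvars c))).

(* Generators of the quadratic module of a clique U to which the inequalities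
   g_j >= 0 with j in Jl are assigned. *)
Definition clique_generators (U : {set 'I_(n.+1 + p)}) (Jl : {set 'I_m}) :
    seq {mpoly R[n.+1 + p]} :=
  x0_var :: [seq ball_poly i | i <- enum U] ++ [seq tilde (g j) | j <- enum Jl].

End POP.

Arguments x0_var {R n p}.
Arguments x_var {R n p} i.
Arguments w_var {R n p} l.
Arguments tilde {R n} p q.
Arguments hprime R {n p} x j.
Arguments clique_generators {R n m p} g U Jl.

(* Main.v *)
Require Import Defs.
Set Warnings "-notation-overridden,-ambiguous-paths,-notation-incompatible-prefix".
From mathcomp Require Import all_boot all_order all_algebra.
From mathcomp Require Import mpoly.
From mathcomp Require Import classical_sets reals constructive_ereal ereal.
From mathcomp Require Import topology normedtype derive.
From mathcomp Require Import boolp ring lra.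

(** On the feasible set of the reformulation the equations h'_l = 0 add up to
    |x~| = 1. If x_0 > 0, then tilde f is x_0 ^ d times the value of f at the
    point x / x_0 of K; if x_0 = 0, it is the value of the leading form of f at
    a point at infinity of K. Hence tilde f is positive on this set
    ([tilde_pos]), and the theorem is an instance of a sparse Positivstellensatz
    of Putinar type on the cube [-1, 1]^N, [sparse_putinar], which is proved
    below by elementary means.

    The constraints are first removed one at a time. If f > 0 on the part of a
    compact set where g >= 0, then f - s ^ 2 * g > 0 on the whole compact set
    for s a multiple of a high power of 1 - g / T: then s ^ 2 * g is small
    where g >= 0, and very negative where g is well below 0 ([penalty]). As
    s only involves the variables of g, the sparsity pattern survives. An
    equation h = 0 is treated as the two constraints h >= 0 and - h >= 0.

    There remains a polynomial f which is positive on the cube and whose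
    monomials live on cliques of a chordal graph. Such a graph has a simplicial
    vertex w ([simplicial_vertex]). Write f = a + b, where a collects the
    monomials that contain w; then a only involves the clique formed by w and
    its neighbours. By [separate] there is a polynomial phi in the neighbours of
    w such that a - phi and b + phi are both still positive on the cube. The
    first one is handled by Putinar's theorem for the cube in the variables of a
    single clique ([putinar_box]), the second one by induction, as w has
    disappeared from it ([sparse_putinar_box]). This induction replaces the
    running intersection property of the maximal cliques.

    Both [separate] and [putinar_box] localize with a polynomial partition of
    unity ([fine_partition]): Bernstein polynomials, that is, products of
    factors (1 + X_i) / 2 and (1 - X_i) / 2, concentrated near the points of a
    grid. For [putinar_box] one must be able to multiply elements of the
    quadratic module M of the cube by such factors. M need not be closed
    under this, but it is up to an arbitrarily small constant ([boxQM_mul1B]), because of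
    Young's inequality: for n a power of two, n * (1 - w) is a sum of squares
    plus 1 - w ^ n, and the last term stays bounded while n grows. *)

Set Implicit Arguments.
Unset Strict Implicit.
Unset Printing Implicit Defensive.

Import Order.TTheory GRing.Theory Num.Theory.
Import numFieldNormedType.Exports.

Local Open Scope classical_set_scope.
Local Open Scope ring_scope.

(** * Polynomials in a given set of variables *)
Section PolyIn.
Context {R : realType} {N : nat}.
Implicit Types (a b r : {mpoly R[N]}) (V W : {set 'I_N}).

Lemma polyInP V a :
  polyIn V a <->
  (forall mm : 'X_{1..N}, mm \in msupp a -> forall i, mm i != 0%N -> i \in V).
Proof.
split=> [/fintype.subsetP aV mm amm i mmi|aV]; last first.
  by apply/fintype.subsetP=> i; rewrite inE => /hasP[mm amm mmi]; exact: aV mmi.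
by apply: aV; rewrite inE; apply/hasP; exists mm.
Qed.

Lemma polyInS V W a : V \subset W -> polyIn V a -> polyIn W a.
Proof. by move=> VW aV; exact: fintype.subset_trans aV VW. Qed.

Lemma polyInC V c : polyIn V (c%:MP : {mpoly R[N]}).
Proof.
apply/polyInP => mm; rewrite msuppC; case: ifP => _ //; rewrite mem_seq1 => /eqP -> i.
by rewrite mnm0E.
Qed.

Lemma polyInD V a b : polyIn V a -> polyIn V b -> polyIn V (a + b).
Proof.
move=> /polyInP aV /polyInP bV; apply/polyInP => mm /msuppD_le.
by rewrite mem_cat => /orP[/aV|/bV].
Qed.

Lemma polyInM V a b : polyIn V a -> polyIn V b -> polyIn V (a * b).
Proof.
move=> /polyInP aV /polyInP bV; apply/polyInP => mm /msuppM_le.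
case/allpairsP => -[m1 m2] /= [am1 bm2 ->] i; rewrite mnmDE addn_eq0 negb_and.
by case/orP => [/(aV _ am1)|/(bV _ bm2)].
Qed.

Lemma polyInX V i : i \in V -> polyIn V ('X_i : {mpoly R[N]}).
Proof.
move=> iV; apply/polyInP => mm; rewrite msuppX inE => /eqP -> j.
by rewrite mnm1E; case: (eqVneq i j) => [<-|_].
Qed.

(** The subalgebra of polynomials in the variables of [V] is generated by
    these variables; most properties of polynomials below are proved along
    this generation. *)
Lemma polyIn_ind V (P : {mpoly R[N]} -> Prop) :
  (forall c, P c%:MP) -> (forall i, i \in V -> P 'X_i) ->
  (forall a b, polyIn V a -> polyIn V b -> P a -> P b -> P (a + b)) ->
  (forall a b, polyIn V a -> polyIn V b -> P a -> P b -> P (a * b)) ->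
  forall a, polyIn V a -> P a.
Proof.
move=> PC PX PD PM a /polyInP aV.
pose Q b := polyIn V b /\ P b.
have QcC c : Q c%:MP by split; [exact: polyInC|].
have QaD b c : Q b -> Q c -> Q (b + c).
  by move=> [? ?] [? ?]; split; [exact: polyInD|exact: PD].
have QmM b c : Q b -> Q c -> Q (b * c).
  by move=> [? ?] [? ?]; split; [exact: polyInM|exact: PM].
suff [] : Q a by [].
rewrite [a]mpolyE big_seq; elim/big_rec: _ => [|mm b /aV mmV Qb].
  by rewrite -mpolyC0.
apply: (QaD) => //; rewrite -mul_mpolyC; apply: (QmM) => //.
rewrite mpolyXE_id; elim/big_rec: _ => [|i c _ Qc]; first by rewrite -mpolyC1.
apply: (QmM) => //; case: (eqVneq (mm i) 0%N) => [->|/mmV iV].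
  by rewrite expr0 -mpolyC1.
elim: (mm i) => [|k IH]; first by rewrite expr0 -mpolyC1.
by rewrite exprS; apply: (QmM) => //; split; [exact: polyInX|exact: PX].
Qed.

Lemma polyIn0 V : polyIn V (0 : {mpoly R[N]}).
Proof. by rewrite -mpolyC0; exact: polyInC. Qed.

Lemma polyIn1 V : polyIn V (1 : {mpoly R[N]}).
Proof. by rewrite -mpolyC1; exact: polyInC. Qed.

Lemma polyInN V a : polyIn V a -> polyIn V (- a).
Proof. by rewrite -mulN1r -mpolyC1 -mpolyCN; apply: polyInM; exact: polyInC. Qed.

Lemma polyInB V a b : polyIn V a -> polyIn V b -> polyIn V (a - b).
Proof. by move=> aV bV; apply: polyInD => //; exact: polyInN. Qed.

Lemma polyInXn V a k : polyIn V a -> polyIn V (a ^+ k).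
Proof.
move=> aV; elim: k => [|k IH]; first exact: polyIn1.
by rewrite exprS; exact: polyInM.
Qed.

Lemma polyIn_sum V (T : eqType) (s : seq T) (P : pred T)
    (F : T -> {mpoly R[N]}) :
  (forall t, t \in s -> P t -> polyIn V (F t)) -> polyIn V (\sum_(t <- s | P t) F t).
Proof.
move=> FV; rewrite big_seq_cond; elim/big_rec: _ => [|t a /andP[ts Pt] aV].
  exact: polyIn0.
by apply: polyInD => //; exact: FV.
Qed.

End PolyIn.

(** * The quadratic module of the cube *)
Section BoxCone.
Context {R : realType} {N : nat}.
Implicit Types (a b r : {mpoly R[N]}) (V W : {set 'I_N}).

(** The quadratic module of the polynomials 1 - X_i ^ 2 with i in V. In this
    form membership statements are proved by induction on generators, without
    carrying multipliers along. *)
Inductive boxQM V : {mpoly R[N]} -> Prop :=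
| BoxSquare r : polyIn V r -> boxQM V (r ^+ 2)
| BoxBall i r : i \in V -> polyIn V r -> boxQM V ((1 - 'X_i ^+ 2) * r ^+ 2)
| BoxAdd a b : boxQM V a -> boxQM V b -> boxQM V (a + b).

Lemma boxQM_polyIn V a : boxQM V a -> polyIn V a.
Proof.
elim=> {a} [r rV|i r iV rV|a b _ aV _ bV]; last exact: polyInD.
  exact: polyInXn.
apply: polyInM; last exact: polyInXn.
by apply: polyInB; [exact: polyIn1|apply: polyInXn; exact: polyInX].
Qed.

Lemma boxQMS V W a : V \subset W -> boxQM V a -> boxQM W a.
Proof.
move=> VW; elim=> {a} [r rV|i r iV rV|a b _ aV _ bV].
- by apply: BoxSquare; exact: polyInS rV.
- by apply: BoxBall; [exact: (fintype.subsetP VW)|exact: polyInS rV].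
- exact: BoxAdd.
Qed.

Lemma boxQM_mulsq V a r : polyIn V r -> boxQM V a -> boxQM V (r ^+ 2 * a).
Proof.
move=> rV; elim=> {a} [s sV|i s iV sV|a b _ aV _ bV].
- by rewrite -exprMn; apply: BoxSquare; exact: polyInM.
- by rewrite mulrCA -exprMn; apply: BoxBall => //; exact: polyInM.
- by rewrite mulrDr; exact: BoxAdd.
Qed.

Lemma boxQM_scale V a c : 0 <= c -> boxQM V a -> boxQM V (c%:MP * a).
Proof.
move=> c0 aV; rewrite -(sqr_sqrtr c0) rmorphXn.
by apply: boxQM_mulsq => //; exact: polyInC.
Qed.

Lemma boxQM_C V c : 0 <= c -> boxQM V c%:MP.
Proof.
move=> c0; rewrite -(sqr_sqrtr c0) rmorphXn.
by apply: BoxSquare; exact: polyInC.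
Qed.

Lemma boxQM0 V : boxQM V 0.
Proof. by rewrite -mpolyC0; exact: boxQM_C. Qed.

Lemma boxQM_sum V (T : eqType) (s : seq T) (P : pred T) (F : T -> {mpoly R[N]}) :
  (forall t, t \in s -> P t -> boxQM V (F t)) -> boxQM V (\sum_(t <- s | P t) F t).
Proof.
move=> FV; rewrite big_seq_cond; elim/big_rec: _ => [|t a /andP[ts Pt] aV].
  exact: boxQM0.
by apply: BoxAdd => //; exact: FV.
Qed.

(** The cone is archimedean. Bounding the square of a polynomial, and not the
    polynomial itself, makes the bounded polynomials a subalgebra. *)
Lemma boxQM_archimedean V a :
  polyIn V a -> exists2 c : R, 0 <= c & boxQM V (c%:MP - a ^+ 2).
Proof.
move: a; apply: polyIn_ind => [c|i iV|a b aV bV [c c0 ca] [d d0 db]|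
  a b aV bV [c c0 ca] [d d0 db]].
- exists (c ^+ 2); first exact: sqr_ge0.
  by rewrite rmorphXn subrr; exact: boxQM0.
- exists 1 => //; rewrite mpolyC1 -[X in boxQM _ X]mulr1 -[X in _ * X](expr1n _ 2).
  by apply: BoxBall => //; exact: polyIn1.
- exists (2 * c + 2 * d); first by lra.
  have -> : (2 * c + 2 * d)%:MP - (a + b) ^+ 2 =
     (2%:MP * (c%:MP - a ^+ 2) + 2%:MP * (d%:MP - b ^+ 2)) + (a - b) ^+ 2.
    by rewrite mpolyCD !mpolyCM; ring.
  apply: BoxAdd; last by apply: BoxSquare; exact: polyInB.
  by apply: BoxAdd; apply: boxQM_scale.
- exists (c * d); first exact: mulr_ge0.
  have -> : (c * d)%:MP - (a * b) ^+ 2 =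
     d%:MP * (c%:MP - a ^+ 2) + a ^+ 2 * (d%:MP - b ^+ 2).
    by rewrite mpolyCM; ring.
  by apply: BoxAdd; [exact: boxQM_scale|exact: boxQM_mulsq].
Qed.

(** c + 1/4 - a = (a - 1/2) ^ 2 + (c - a ^ 2). *)
Lemma boxQM_bounded V a :
  polyIn V a -> exists2 c : R, 0 <= c & boxQM V (c%:MP - a).
Proof.
move=> aV; have [c c0 ca] := boxQM_archimedean aV.
pose h : R := 2^-1.
exists (c + h ^+ 2); first by rewrite addr_ge0 ?sqr_ge0.
have e : 2 * h%:MP_[N] = 1.
  by rewrite -mpolyC_nat -mpolyCM mulfV ?pnatr_eq0 // mpolyC1.
have -> : (c + h ^+ 2)%:MP - a = (a - h%:MP) ^+ 2 + (c%:MP - a ^+ 2).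
  by rewrite -[X in _ - X = _]mul1r -e mpolyCD rmorphXn /=; ring.
apply: BoxAdd => //; apply: BoxSquare.
by apply: polyInB => //; exact: polyInC.
Qed.

End BoxCone.

(** * Multiplication by 1 - X_i and 1 + X_i *)
Section Closure.
Context {R : realType} {N : nat}.
Implicit Types (a b r w : {mpoly R[N]}) (V W : {set 'I_N}).

Lemma boxQM_1Bpow V w j :
  polyIn V w -> boxQM V (1 - w ^+ 2) -> boxQM V (1 - w ^+ (2 * j)).
Proof.
move=> wV w1; elim: j => [|j IH]; first by rewrite muln0 expr0 subrr; exact: boxQM0.
have -> : 1 - w ^+ (2 * j.+1) = (1 - w ^+ 2) + w ^+ 2 * (1 - w ^+ (2 * j)).
  by rewrite mulnS exprD; ring.
by apply: BoxAdd => //; exact: boxQM_mulsq.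
Qed.

(** Young's inequality w ^ n - n * w + n - 1 >= 0 has an explicit
    certificate when n is a power of two: with p_n its left-hand side,
    p_(2n) = (w ^ n - 1) ^ 2 + 2 * p_n. The factor b is there because the square
    terms may be multiplied by any element of the module. *)
Lemma boxQM_young V w b k : polyIn V w -> boxQM V b ->
  boxQM V ((w ^+ (2 ^ k) - (2 ^ k)%:R * w + (2 ^ k)%:R - 1) * b).
Proof.
move=> wV bV; elim: k => [|k IH].
  by rewrite expn0 expr1 mul1r subrr add0r subrr mul0r; exact: boxQM0.
have -> : (w ^+ (2 ^ k.+1) - (2 ^ k.+1)%:R * w + (2 ^ k.+1)%:R - 1) * b =
  (w ^+ (2 ^ k) - 1) ^+ 2 * b +
   ((w ^+ (2 ^ k) - (2 ^ k)%:R * w + (2 ^ k)%:R - 1) * b +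
    (w ^+ (2 ^ k) - (2 ^ k)%:R * w + (2 ^ k)%:R - 1) * b).
  by rewrite expnS natrM mulnC exprM; ring.
apply: BoxAdd; last exact: BoxAdd.
by apply: boxQM_mulsq => //; apply: polyInB; [exact: polyInXn|exact: polyIn1].
Qed.

(** For n = 2 ^ k, choose C with C - b in the module. The elements of
    [boxQM_young], w ^ n * (C - b), C * (1 - w ^ n) and b add up to
    n * (1 - w) * b + C, and dividing by n makes the constant as small as
    desired. *)
Lemma boxQM_mul1B V w b eps : polyIn V w -> boxQM V (1 - w ^+ 2) ->
  boxQM V b -> 0 < eps -> boxQM V (eps%:MP + (1 - w) * b).
Proof.
move=> wV w1 bV eps0; have [C C0 CbV] := boxQM_bounded (boxQM_polyIn bV).
pose k := (Num.bound (C / eps)).+1; pose n := (2 ^ k)%N.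
have n0 : 0 < n%:R :> R by rewrite ltr0n expn_gt0.
have Cn : C / n%:R <= eps.
  rewrite ler_pdivrMr // -ler_pdivrMl // mulrC.
  have /ltW/le_trans := archi_boundP (divr_ge0 C0 (ltW eps0)); apply.
  rewrite ler_nat; apply: ltnW; apply: leq_trans (ltn_expl _ _) => //.
have nE : n = (2 * 2 ^ k.-1)%N by rewrite -expnS.
have main : boxQM V (n%:R * ((1 - w) * b) + C%:MP).
  have -> : n%:R * ((1 - w) * b) + C%:MP =
    (w ^+ n - n%:R * w + n%:R - 1) * b + w ^+ n * (C%:MP - b)
    + C%:MP * (1 - w ^+ n) + b by ring.
  apply: BoxAdd => //; apply: BoxAdd; first apply: BoxAdd.
  - exact: boxQM_young.
  - by rewrite nE mulnC exprM; apply: boxQM_mulsq => //; exact: polyInXn.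
  - by apply: boxQM_scale => //; rewrite nE; exact: boxQM_1Bpow.
have nV : n%:R^-1%:MP * n%:R = 1 :> {mpoly R[N]}.
  by rewrite -mpolyC_nat -mpolyCM mulVf ?mpolyC1 // gt_eqF.
have -> : eps%:MP + (1 - w) * b =
   n%:R^-1%:MP * (n%:R * ((1 - w) * b) + C%:MP) + (eps - C / n%:R)%:MP.
  by rewrite mulrDr (mulrA _ n%:R) nV mul1r mpolyCB mpolyCM; ring.
apply: BoxAdd; first by apply: boxQM_scale => //; rewrite invr_ge0 ltW.
by apply: boxQM_C; rewrite subr_ge0.
Qed.

(** As 1 is an interior point of the archimedean module, this is the closure of
    the module in the finest locally convex topology of R[V]. *)
Definition boxQMc V a := forall eps, 0 < eps -> boxQM V (eps%:MP + a).

Lemma boxQMc_boxQM V a : boxQM V a -> boxQMc V a.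
Proof. by move=> aV eps e0; apply: BoxAdd => //; apply: boxQM_C; exact: ltW. Qed.

Lemma boxQMc_add V a b : boxQMc V a -> boxQMc V b -> boxQMc V (a + b).
Proof.
move=> aV bV eps e0; have e2 : 0 < eps / 2 by lra.
have -> : eps%:MP + (a + b) = ((eps / 2)%:MP + a) + ((eps / 2)%:MP + b).
  by rewrite [in LHS](splitr eps) mpolyCD; ring.
by apply: BoxAdd; [exact: aV|exact: bV].
Qed.

Lemma boxQMc_sum V (T : eqType) (s : seq T) (P : pred T) (F : T -> {mpoly R[N]}) :
  (forall t, t \in s -> P t -> boxQMc V (F t)) -> boxQMc V (\sum_(t <- s | P t) F t).
Proof.
move=> FV; rewrite big_seq_cond; elim/big_rec: _ => [|t a /andP[ts Pt] aV].
  exact/boxQMc_boxQM/boxQM0.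
by apply: boxQMc_add => //; exact: FV.
Qed.

Lemma boxQMc_mulC V c a : 0 <= c -> boxQMc V a -> boxQMc V (c%:MP * a).
Proof.
move=> c0 aV eps e0; have c1 : 0 < c + 1 by lra.
have -> : eps%:MP + c%:MP * a =
    c%:MP * ((eps / (c + 1))%:MP + a) + (eps - c * (eps / (c + 1)))%:MP.
  by rewrite mpolyCB !mpolyCM; ring.
apply: BoxAdd; first by apply: boxQM_scale => //; apply: aV; exact: divr_gt0.
apply: boxQM_C; rewrite subr_ge0 mulrCA ger_pMr // ler_pdivrMr // mul1r; lra.
Qed.

(** The constant eps lost by replacing a with eps + a is multiplied by
    1 - w, which is bounded in the module. *)
Lemma boxQMc_mul1B V w a : polyIn V w -> boxQM V (1 - w ^+ 2) ->
  boxQMc V a -> boxQMc V ((1 - w) * a).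
Proof.
move=> wV w1 aV eps e0.
have [C C0 CV] := boxQM_bounded (polyInB (polyIn1 V) wV).
have C1 : 0 < C + 1 by lra.
pose d := eps / (2 * (C + 1)); have d0 : 0 < d by apply: divr_gt0; lra.
have dC : d * C <= eps / 2.
  by rewrite /d invfM mulrA -mulrA ger_pMr ?divr_gt0 // ler_pdivrMl // mulr1; lra.
have e2 : 0 < eps / 2 by lra.
have -> : eps%:MP + (1 - w) * a =
  ((eps / 2)%:MP + (1 - w) * (d%:MP + a)) + d%:MP * (C%:MP - (1 - w))
  + (eps / 2 - d * C)%:MP.
  by rewrite [in LHS](splitr eps) mpolyCD mpolyCB (mpolyCM _ d); ring.
apply: BoxAdd; last by apply: boxQM_C; rewrite subr_ge0.
apply: BoxAdd; last by apply: boxQM_scale => //; exact: ltW.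
by apply: boxQM_mul1B => //; exact: aV.
Qed.

(** * Bernstein partitions of unity *)

(** Weights are the polynomials by which inequalities may be multiplied. *)
Definition weight V b := polyIn V b /\
  forall W a, V \subset W -> boxQMc W a -> boxQMc W (b * a).

Lemma weight1 V : weight V 1.
Proof. by split=> [|W a _]; [exact: polyIn1|rewrite mul1r]. Qed.

Lemma weightM V a b : weight V a -> weight V b -> weight V (a * b).
Proof.
move=> [aV aw] [bV bw]; split=> [|W c VW cW]; first exact: polyInM.
by rewrite -mulrA; apply: aw => //; exact: bw.
Qed.

Lemma weightS V W b : V \subset W -> weight V b -> weight W b.
Proof.
move=> VW [bV bw]; split=> [|U c WU]; first exact: polyInS bV.
by apply: bw; exact: fintype.subset_trans WU.
Qed.

Lemma weight_half V i : i \in V ->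
  weight V (2^-1%:MP * (1 + 'X_i)) /\ weight V (2^-1%:MP * (1 - 'X_i)).
Proof.
move=> iV; have Xi := @polyInX R _ _ _ iV.
have XN : polyIn V (- 'X_i : {mpoly R[N]}) by exact: polyInN.
have ball W : V \subset W -> boxQM W (1 - 'X_i ^+ 2 : {mpoly R[N]}).
  move=> VW; rewrite -[X in boxQM _ X]mulr1 -[X in _ * X](expr1n _ 2).
  by apply: BoxBall; [exact: (fintype.subsetP VW)|exact: polyIn1].
split; split=> [|W c VW cW].
- by apply: polyInM; [exact: polyInC|apply: polyInD => //; exact: polyIn1].
- rewrite -mulrA -[X in 1 + X]opprK; apply: boxQMc_mulC => //.
  by apply: boxQMc_mul1B => //; rewrite ?sqrrN; [exact: polyInS XN|exact: ball].
- by apply: polyInM; [exact: polyInC|apply: polyInB => //; exact: polyIn1].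
- rewrite -mulrA; apply: boxQMc_mulC => //.
  by apply: boxQMc_mul1B => //; [exact: polyInS Xi|exact: ball].
Qed.

(** The coefficients are the probabilities of the paths of a random walk of k
    steps, a step being +1 with probability (1 + X_i) / 2 and -1 with probability
    (1 - X_i) / 2, and the second components are the end points. The last
    equation is the variance of the end point; it grows by 1 - X_i ^ 2 at each
    step because the steps are independent. No binomial coefficient appears, as
    paths with the same end point are kept apart. *)
Lemma walk_partition i k : exists F : seq ({mpoly R[N]} * R),
  [/\ forall s, s \in F -> weight [set i]%SET s.1 /\ `|s.2| <= k%:R,
      \sum_(s <- F) s.1 = 1
    & \sum_(s <- F) s.1 * (k%:R * 'X_i - s.2%:MP) ^+ 2 = k%:R * (1 - 'X_i ^+ 2)].
Proof.
have e : 2 * 2^-1%:MP_[N] = 1 :> {mpoly R[N]}.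
  by rewrite -mpolyC_nat -mpolyCM mulfV ?pnatr_eq0 // mpolyC1.
have [wp wm] := weight_half (set11 i).
elim: k => [|k [F [FG F1 F2]]].
  exists [:: (1, 0)]; split=> [s||]; last 2 first.
  - by rewrite big_seq1.
  - by rewrite big_seq1 /= mpolyC0 !mul0r subrr expr0n mulr0.
  by rewrite inE => /eqP -> /=; rewrite normr0; split=> //; exact: weight1.
pose hp : {mpoly R[N]} := 2^-1%:MP * (1 + 'X_i).
pose hm : {mpoly R[N]} := 2^-1%:MP * (1 - 'X_i).
exists ([seq (s.1 * hp, s.2 + 1) | s <- F] ++ [seq (s.1 * hm, s.2 - 1) | s <- F]).
split=> [s||].
- rewrite mem_cat => /orP[] /mapP[t /FG[tw tk] ->] /=; split; try exact: weightM.
  + by rewrite (le_trans (ler_normD _ _)) // normr1 -[k.+1%:R]natr1 lerD2r.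
  + by rewrite (le_trans (ler_normB _ _)) // normr1 -[k.+1%:R]natr1 lerD2r.
- rewrite big_cat /= !big_map -big_split /= -[RHS]F1; apply: eq_bigr => s _.
  by rewrite /hp /hm -[RHS]mul1r -[X in _ = X * _]e; ring.
rewrite big_cat /= !big_map -big_split /=.
rewrite (eq_bigr (fun s : {mpoly R[N]} * R =>
   s.1 * (k%:R * 'X_i - s.2%:MP) ^+ 2 + s.1 * (1 - 'X_i ^+ 2))); last first.
  move=> s _; rewrite mpolyCD mpolyCB mpolyC1 -natr1 /hp /hm.
  by rewrite -[RHS]mul1r -[X in _ = X * _]e; ring.
by rewrite big_split /= F2 -mulr_suml F1 -natr1; ring.
Qed.

Definition box (y : 'rV[R]_N) := forall i, `|y ord0 i| <= 1.

(** Products over the variables of the families of [walk_partition], the end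
    points being scaled by 1 / k so as to lie in the cube. *)
Lemma grid_partition (k : nat) (ys : seq 'I_N) : (0 < k)%N -> uniq ys ->
  exists F : seq ({mpoly R[N]} * 'rV[R]_N),
  [/\ forall s, s \in F -> weight [set i in ys]%SET s.1 /\ box s.2,
      \sum_(s <- F) s.1 = 1
    & forall i, i \in ys -> \sum_(s <- F) s.1 * ('X_i - (s.2 ord0 i)%:MP) ^+ 2
        = k%:R^-1%:MP * (1 - 'X_i ^+ 2)].
Proof.
move=> k0; have k0' : 0 < k%:R :> R by rewrite ltr0n.
have kV : k%:R^-1%:MP * k%:R = 1 :> {mpoly R[N]}.
  by rewrite -mpolyC_nat -mpolyCM mulVf ?mpolyC1 // gt_eqF.
elim: ys => [_|v ys IH /= /andP[vys /IH[F [FG F1 F2]]]].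
  exists [:: (1, 0)]; split=> [s||//]; last by rewrite big_seq1.
  rewrite inE => /eqP -> /=; split; first exact: weight1.
  by move=> i; rewrite mxE normr0.
have [G [GG G1 G2]] := walk_partition v k.
(* The end point of the walk in the direction v becomes the v-th coordinate. *)
pose pt (y : 'rV[R]_N) t : 'rV[R]_N := \row_j if j == v then t / k%:R else y ord0 j.
exists [seq (s.1 * t.1, pt s.2 t.2) | s <- F, t <- G]; split=> [s||i].
- case/allpairsP=> -[p r] /= [/FG[pw pb] /GG[rw rk] ->] /=; split.
    apply: weightM; [apply: weightS pw|apply: weightS rw]; apply/fintype.subsetP => j.
      by rewrite !inE => ->; rewrite orbT.
    by rewrite !inE => ->.
  move=> j; rewrite mxE; case: eqP => // _.
  by rewrite normrM normfV (gtr0_norm k0') ler_pdivrMr // mul1r.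
- rewrite big_allpairs_dep -[RHS]F1; apply: eq_bigr => s _ /=.
  by rewrite -mulr_sumr G1 mulr1.
rewrite inE big_allpairs_dep; case: eqVneq => [-> _|iv /= iys].
  rewrite /= -[RHS]mul1r -[X in _ = X * _]F1 mulr_suml; apply: eq_bigr => s _.
  have -> : k%:R^-1%:MP * (1 - 'X_v ^+ 2) =
      (k%:R^-1%:MP) ^+ 2 * (k%:R * (1 - 'X_v ^+ 2)) :> {mpoly R[N]}.
    by rewrite expr2 -mulrA (mulrA _ k%:R) kV mul1r.
  rewrite -G2 !mulr_sumr; apply: eq_bigr => t _.
  rewrite mxE eqxx -mulrA (mulrCA (_ ^+ 2) t.1) -exprMn; congr (_ * (_ * _ ^+ 2)).
  by rewrite mulrBr mulrA kV mul1r mpolyCM mulrC.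
rewrite -F2 //; apply: eq_bigr => s _; rewrite -[RHS]mulr1 -G1 mulr_sumr.
by apply: eq_bigr => t _; rewrite mxE (negbTE iv) /=; ring.
Qed.

Definition sqdist V (y : 'rV[R]_N) : {mpoly R[N]} :=
  \sum_(i in V) ('X_i - (y ord0 i)%:MP) ^+ 2.

Lemma fine_partition V eta : 0 < eta ->
  exists F : seq ({mpoly R[N]} * 'rV[R]_N),
  [/\ forall s, s \in F -> weight V s.1 /\ box s.2,
      \sum_(s <- F) s.1 = 1
    & boxQM V (eta%:MP - \sum_(s <- F) s.1 * sqdist V s.2)].
Proof.
move=> eta0; pose c := #|V|%:R / eta; pose k := (Num.bound c).+1.
have c0 : 0 <= c by rewrite divr_ge0 // ltW.
have k0 : 0 < k%:R :> R by rewrite ltr0n.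
have kV : #|V|%:R * k%:R^-1 <= eta.
  rewrite ler_pdivrMr // -ler_pdivrMl // mulrC.
  by rewrite (le_trans (ltW (archi_boundP c0))) // ler_nat leqnSn.
have [F [FG F1 F2]] := @grid_partition k (enum V) isT (enum_uniq _).
exists F; split=> //; first by move=> s /FG; rewrite set_enum.
have -> : \sum_(s <- F) s.1 * sqdist V s.2 =
    \sum_(i in V) k%:R^-1%:MP * (1 - 'X_i ^+ 2).
  under eq_bigr => s _ do rewrite /sqdist mulr_sumr.
  by rewrite exchange_big /=; apply: eq_bigr => i iV; rewrite F2 // mem_enum.
have -> : eta%:MP - \sum_(i in V) k%:R^-1%:MP * (1 - 'X_i ^+ 2) =
   (eta - #|V|%:R * k%:R^-1)%:MP + \sum_(i in V) k%:R^-1%:MP * 'X_i ^+ 2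
   :> {mpoly R[N]}.
  rewrite -[in LHS]mulr_sumr sumrB sumr_const mpolyCB mpolyCM mpolyC_nat.
  by rewrite -mulr_sumr; ring.
apply: BoxAdd; first by apply: boxQM_C; rewrite subr_ge0.
apply: boxQM_sum => i _ iV; apply: boxQM_scale; first by rewrite invr_ge0 ltW.
by apply: BoxSquare; exact: polyInX.
Qed.

End Closure.

(** * Putinar's theorem on the cube, and separation of variables *)
Section Evaluation.
Context {R : realType} {N : nat}.
Implicit Types (a b f : {mpoly R[N]}) (V W A B : {set 'I_N}) (y z : 'rV[R]_N).

Lemma eval_agree V a y z : polyIn V a ->
  (forall i, i \in V -> y ord0 i = z ord0 i) -> eval_at a y = eval_at a z.
Proof.
move=> aV yz; move: a aV; apply: polyIn_ind => [c|i iV|a b _ _ Ea Eb|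
  a b _ _ Ea Eb]; rewrite /eval_at.
- by rewrite !mevalC.
- by rewrite !mevalXU yz.
- by rewrite !mevalD; congr (_ + _).
- by rewrite !mevalM; congr (_ * _).
Qed.

Lemma polyIn_setT a : polyIn [set: 'I_N]%SET a.
Proof. exact: finset.subsetT. Qed.

Lemma boxQM_ge0 V a y : boxQM V a -> box y -> 0 <= eval_at a y.
Proof.
move=> aV yb; elim: aV => {a} [r _|i r _ _|a b _ a0 _ b0]; rewrite /eval_at.
- by rewrite rmorphXn sqr_ge0.
- rewrite mevalM mevalB meval1 !rmorphXn /= mevalXU mulr_ge0 ?sqr_ge0 //.
  by rewrite subr_ge0 -real_normK ?num_real // expr_le1.
- by rewrite mevalD addr_ge0.
Qed.

Lemma boxQMc_ge0 V a y : boxQMc V a -> box y -> 0 <= eval_at a y.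
Proof.
move=> aV yb; apply/ler_addgt0Pl => eps e0.
by have := boxQM_ge0 (aV _ e0) yb; rewrite /eval_at mevalD mevalC.
Qed.

Lemma weight_ge0 V b y : weight V b -> box y -> 0 <= eval_at b y.
Proof.
move=> [_ /(_ V 1 (fintype.subxx V)) bV] yb.
have := boxQMc_ge0 (bV _) yb; rewrite mulr1; apply.
by apply: boxQMc_boxQM; rewrite -mpolyC1; exact: boxQM_C.
Qed.

Lemma eval_bounded a : exists2 C : R, 0 <= C & forall y, box y -> `|eval_at a y| <= C.
Proof.
have [C C0 CV] := boxQM_archimedean (polyIn_setT a).
exists (Num.sqrt C) => [|y yb]; first exact: sqrtr_ge0.
have := boxQM_ge0 CV yb; rewrite /eval_at mevalB mevalC rmorphXn /= subr_ge0.
by rewrite -sqrtr_sqr; exact: ler_wsqrtr.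
Qed.

Lemma eval_sqdist V y z :
  eval_at (sqdist V z) y = \sum_(i in V) (y ord0 i - z ord0 i) ^+ 2.
Proof.
rewrite /eval_at raddf_sum; apply: eq_bigr => i _ /=.
by rewrite rmorphXn /= mevalB mevalXU mevalC.
Qed.

(** A Lipschitz estimate |a - a(y)| ^ 2 <= C * |X - y| ^ 2 holds inside the
    module, with a constant that is uniform in y. Squares make it stable under
    products: (a - a(y)) * b is controlled by the bound on b ^ 2. *)
Lemma lipschitz_sq V a : polyIn V a -> exists2 C : R, 0 <= C &
  forall y, box y ->
    boxQM V (C%:MP * sqdist V y - (a - (eval_at a y)%:MP) ^+ 2).
Proof.
move: a; apply: polyIn_ind => [c|i iV|a b aV bV [c c0 ca] [d d0 db]|
  a b aV bV [c c0 ca] [d d0 db]].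
- exists 0 => // y _; rewrite /eval_at mevalC subrr expr0n mpolyC0 mul0r subr0.
  exact: boxQM0.
- exists 1 => // y yb; rewrite mpolyC1 mul1r /sqdist (bigD1 i) //=.
  rewrite /eval_at mevalXU addrAC subrr add0r; apply: boxQM_sum => j _ /andP[jV _].
  by apply: BoxSquare; apply: polyInB; [exact: polyInX|exact: polyInC].
- exists (2 * c + 2 * d) => [|y yb]; first by lra.
  rewrite /eval_at mevalD -/(eval_at _ _) -/(eval_at _ _).
  set av := eval_at a y; set bv := eval_at b y.
  have -> : (2 * c + 2 * d)%:MP * sqdist V y - (a + b - (av + bv)%:MP) ^+ 2 =
    2%:MP * (c%:MP * sqdist V y - (a - av%:MP) ^+ 2)
    + 2%:MP * (d%:MP * sqdist V y - (b - bv%:MP) ^+ 2)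
    + ((a - av%:MP) - (b - bv%:MP)) ^+ 2.
    by rewrite !mpolyCD !mpolyCM; ring.
  apply: BoxAdd; last first.
    by apply: BoxSquare; apply: polyInB; apply: polyInB => //; exact: polyInC.
  by apply: BoxAdd; apply: boxQM_scale => //; [exact: ca|exact: db].
- have [ka ka0 kaV] := boxQM_archimedean aV.
  have [kb kb0 kbV] := boxQM_archimedean bV.
  exists (2 * kb * c + 2 * ka * d) => [|y yb].
    by rewrite addr_ge0 // !mulr_ge0.
  rewrite /eval_at mevalM -/(eval_at _ _) -/(eval_at _ _).
  set av := eval_at a y; set bv := eval_at b y.
  have avk : 0 <= ka - av ^+ 2.
    by have := boxQM_ge0 kaV yb; rewrite /eval_at mevalB mevalC rmorphXn.
  have -> : (2 * kb * c + 2 * ka * d)%:MP * sqdist V y - (a * b - (av * bv)%:MP) ^+ 2 =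
    2%:MP * (kb%:MP * (c%:MP * sqdist V y - (a - av%:MP) ^+ 2))
    + 2%:MP * ((a - av%:MP) ^+ 2 * (kb%:MP - b ^+ 2))
    + 2%:MP * (ka%:MP * (d%:MP * sqdist V y - (b - bv%:MP) ^+ 2))
    + 2%:MP * ((ka - av ^+ 2)%:MP * (b - bv%:MP) ^+ 2)
    + ((a - av%:MP) * b - av%:MP * (b - bv%:MP)) ^+ 2.
    by rewrite mpolyCD mpolyCB !mpolyCM; ring.
  have aB : polyIn V (a - av%:MP) by apply: polyInB => //; exact: polyInC.
  have bB : polyIn V (b - bv%:MP) by apply: polyInB => //; exact: polyInC.
  apply: BoxAdd; last first.
    apply: BoxSquare; apply: polyInB; apply: polyInM => //; exact: polyInC.
  apply: BoxAdd; first apply: BoxAdd; first apply: BoxAdd; apply: boxQM_scale => //.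
  + by apply: boxQM_scale => //; exact: ca.
  + exact: boxQM_mulsq.
  + by apply: boxQM_scale => //; exact: db.
  + by apply: boxQM_scale => //; exact: BoxSquare.
Qed.

(** With x = a - a(y), the inequality eps + x + x ^ 2 / (4 * eps) >= 0 is a
    perfect square, which turns the quadratic estimate into a linear one. *)
Lemma lipschitz V a eps : polyIn V a -> 0 < eps -> exists2 C : R, 0 <= C &
  forall y, box y ->
    boxQM V (eps%:MP + C%:MP * sqdist V y + (a - (eval_at a y)%:MP)).
Proof.
move=> aV e0; have [C C0 CV] := lipschitz_sq aV.
pose h : R := (4 * eps)^-1; have h0 : 0 <= h by rewrite invr_ge0; lra.
have eh : eps = h * (2 * eps) ^+ 2.
  by rewrite /h expr2 invfM; field; rewrite gt_eqF.
have h1 : 1 = h * (2 * (2 * eps)) by rewrite /h invfM; field; rewrite gt_eqF.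
exists (h * C) => [|y yb]; first exact: mulr_ge0.
set av := eval_at a y; set x := a - av%:MP.
have -> : eps%:MP + (h * C)%:MP * sqdist V y + x =
   h%:MP * ((x + (2 * eps)%:MP) ^+ 2 + (C%:MP * sqdist V y - x ^+ 2)).
  rewrite [in LHS]eh -[X in _ + X = _]mul1r -(mpolyC1 _ R) [X in X%:MP * x]h1.
  by rewrite !mpolyCM; ring.
apply: boxQM_scale => //; apply: BoxAdd; last exact: CV.
by apply: BoxSquare; apply: polyInD; [apply: polyInB|]; rewrite //; exact: polyInC.
Qed.

(** Near each grid point y the polynomial f is at least f(y) - eps, up to the
    error C * |X - y| ^ 2, inside the module. Multiplying by the weights and
    summing, the error terms sum up to at most C * eta. *)
Theorem putinar_box V f delta : polyIn V f -> 0 < delta ->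
  (forall y, box y -> delta <= eval_at f y) -> boxQM V f.
Proof.
move=> fV d0 fd; have d4 : 0 < delta / 4 by lra.
have [C C0 CV] := lipschitz fV d4.
pose eta := delta / (4 * (C + 1)); have C1 : 0 < C + 1 by lra.
have eta0 : 0 < eta by apply: divr_gt0 => //; lra.
have Ceta : C * eta <= delta / 4.
  rewrite /eta invfM (mulrA delta) mulrCA ger_pMr //.
  by rewrite ler_pdivrMr // mul1r; lra.
have [F [FG F1 F2]] := fine_partition V eta0.
have Fsum c : \sum_(s <- F) s.1 * c = c by rewrite -mulr_suml F1 mul1r.
pose g := \sum_(s <- F) s.1 * ((delta / 4)%:MP + C%:MP * sqdist V s.2
            + (f - (eval_at f s.2)%:MP))
          + \sum_(s <- F) s.1 * (eval_at f s.2 - delta)%:MP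
          + C%:MP * (eta%:MP - \sum_(s <- F) s.1 * sqdist V s.2).
have gV : boxQMc V g.
  apply: boxQMc_add; last by apply: boxQMc_mulC => //; exact: boxQMc_boxQM.
  apply: boxQMc_add; apply: boxQMc_sum => s /FG[[_ sw] sb] _; apply: sw => //;
    apply: boxQMc_boxQM; first exact: CV.
  by apply: boxQM_C; rewrite subr_ge0; exact: fd.
have gE : g = (delta / 4 + C * eta - delta)%:MP + f.
  rewrite /g mulrBr mulr_sumr -mpolyCM -[(C * eta)%:MP]Fsum -big_split -sumrB.
  rewrite -big_split -[RHS]Fsum /=; apply: eq_bigr => s _.
  by rewrite !mpolyCB !mpolyCD; ring.
have -> : f = ((delta / 4)%:MP + g) + (delta / 2 - C * eta)%:MP.
  have e : delta / 4 + (delta / 4 + C * eta - delta) + (delta / 2 - C * eta) = 0.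
    by lra.
  by rewrite gE addrA -mpolyCD addrAC -mpolyCD e mpolyC0 add0r.
apply: BoxAdd; first exact: gV.
by apply: boxQM_C; lra.
Qed.

Definition patch V y z : 'rV[R]_N := \row_i if i \in V then y ord0 i else z ord0 i.

Lemma box_patch V y z : box y -> box z -> box (patch V y z).
Proof. by move=> yb zb i; rewrite mxE; case: ifP. Qed.

(** Moving only the coordinates in V costs no more than the distance between
    these coordinates. *)
Lemma patch_lipschitz V a eps : 0 < eps -> exists2 C : R, 0 <= C &
  forall y z, box y -> box z ->
    eval_at a (patch V y z) - eps - C * eval_at (sqdist V y) z <= eval_at a z.
Proof.
move=> e0; have [C C0 CV] := lipschitz (polyIn_setT a) e0.
exists C => // y z yb zb; have pb := box_patch V yb zb.
have := boxQM_ge0 (CV _ pb) zb.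
rewrite {1}/eval_at !mevalD mevalM !mevalN !mevalC -!/(eval_at _ _) !eval_sqdist.
suff -> : \sum_(i in [set: 'I_N]%SET) (z ord0 i - patch V y z ord0 i) ^+ 2 =
   \sum_(i in V) (z ord0 i - y ord0 i) ^+ 2 by lra.
rewrite [RHS]big_mkcond; apply: eq_big => i; rewrite ?inE // mxE => _.
by case: ifP; rewrite ?subrr ?expr0n.
Qed.

(** Let Y be the set of the common variables. For y in the cube of Y, subtract
    from a the constant c(y), slightly less than the infimum of a on the fibre
    over y: then a - c(y) and b + c(y) are both positive on this fibre, since
    the fibre of the cube is the product of the fibres for the variables of a
    and those of b. The Bernstein approximation phi of the function c inherits
    these inequalities because a and b vary little between a point and the
    nearby grid points. *)
Lemma separate A B a b delta : polyIn A a -> polyIn B b -> 0 < delta ->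
  (forall y, box y -> delta <= eval_at (a + b) y) ->
  exists phi, [/\ polyIn (A :&: B) phi,
    forall y, box y -> delta / 4 <= eval_at (a - phi) y
  & forall y, box y -> delta / 4 <= eval_at (b + phi) y].
Proof.
move=> aA bB d0 ab; set Y := (A :&: B)%SET; have d8 : 0 < delta / 8 by lra.
have [Ca Ca0 CaP] := patch_lipschitz Y a d8.
have [Cb Cb0 CbP] := patch_lipschitz Y b d8.
pose C := Ca + Cb + 1; have C0 : 0 < C by rewrite /C; lra.
pose eta := delta / (8 * C); have eta0 : 0 < eta by apply: divr_gt0 => //; lra.
have Ceta : C * eta = delta / 8 by rewrite /eta; field; rewrite gt_eqF.
have [F [FG F1 F2]] := fine_partition Y eta0.
have [Ba _ BaP] := eval_bounded a.
pose S (xi : 'rV[R]_N) := [set eval_at a (patch Y xi z) | z in [set z | box z]].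
have box0 : box (0 : 'rV[R]_N) by move=> i; rewrite mxE normr0.
have Slow xi : box xi -> has_lbound (S xi).
  move=> xib; exists (- Ba) => _ [z zb <-].
  by have := BaP _ (box_patch Y xib zb); rewrite ler_norml => /andP[].
have S0 xi : S xi !=set0 by exists (eval_at a (patch Y xi 0)), 0.
pose c xi := inf (S xi) - delta / 2.
have ca xi z : box xi -> box z -> c xi + delta / 2 <= eval_at a (patch Y xi z).
  by move=> xib zb; rewrite /c subrK; apply: ge_inf; [exact: Slow|exists z].
have cb xi z : box xi -> box z -> delta / 2 - c xi <= eval_at b (patch Y xi z).
  move=> xib zb; rewrite /c.
  suff : delta - eval_at b (patch Y xi z) <= inf (S xi) by lra.
  apply: lb_le_inf => // _ [z' zb' <-]; rewrite lerBlDr.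
  have := ab _ (box_patch A (box_patch Y xib zb') (box_patch Y xib zb)).
  rewrite /eval_at mevalD -!/(eval_at _ _).
  rewrite (eval_agree (z := patch Y xi z') aA); last by move=> i iA; rewrite mxE iA.
  rewrite [eval_at b _](eval_agree (z := patch Y xi z) bB) //.
  by move=> i iB; rewrite !mxE inE iB andbT; case: (i \in A).
pose phi := \sum_(s <- F) s.1 * (c s.2)%:MP : {mpoly R[N]}.
have phiE y : eval_at phi y = \sum_(s <- F) eval_at s.1 y * c s.2.
  by rewrite /eval_at raddf_sum; apply: eq_bigr => s _ /=; rewrite mevalM mevalC.
have Fy y : \sum_(s <- F) eval_at s.1 y = 1.
  by have := congr1 (fun p => eval_at p y) F1; rewrite /eval_at raddf_sum meval1.
have Fd y : box y ->
    \sum_(s <- F) eval_at s.1 y * (C * eval_at (sqdist Y s.2) y) <= delta / 8.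
  move=> yb; have := boxQM_ge0 F2 yb.
  rewrite /eval_at mevalB mevalC subr_ge0 raddf_sum /= -(ler_pM2l C0) Ceta.
  apply: le_trans; rewrite mulr_sumr; apply: ler_sum => s _.
  by rewrite mevalM mulrCA.
have avg y (G : 'rV[R]_N -> R) : box y ->
    (forall xi, box xi -> delta / 8 * 3 - C * eval_at (sqdist Y xi) y <= G xi) ->
    delta / 4 <= \sum_(s <- F) eval_at s.1 y * G s.2.
  move=> yb GP; apply: (@le_trans _ _ (\sum_(s <- F) eval_at s.1 y *
       (delta / 8 * 3 - C * eval_at (sqdist Y s.2) y))).
    under eq_bigr => s _ do rewrite mulrBr.
    by rewrite sumrB -mulr_suml Fy mul1r; have := Fd y yb; lra.
  rewrite big_seq [leRHS]big_seq; apply: ler_sum => s /FG[sw sb].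
  by apply: ler_wpM2l; [exact: weight_ge0 sw yb|exact: GP].
have dist0 xi y : 0 <= eval_at (sqdist Y xi) y.
  by rewrite eval_sqdist sumr_ge0 // => i _; exact: sqr_ge0.
exists phi; split=> [|y yb|y yb].
- by apply: polyIn_sum => s /FG[[sY _] _] _; apply: polyInM => //; exact: polyInC.
- rewrite /eval_at mevalB -!/(eval_at _ _) phiE -[eval_at a y]mul1r -[X in X * _ - _](Fy y).
  rewrite mulr_suml -sumrB; under eq_bigr => s _ do rewrite -mulrBr.
  apply: (avg _ (fun xi => eval_at a y - c xi)) => // xi xib.
  have := CaP xi y xib yb; have := ca xi y xib yb; have := dist0 xi y.
  by rewrite /C; nra.
- rewrite /eval_at mevalD -!/(eval_at _ _) phiE -[eval_at b y]mul1r -[X in X * _ + _](Fy y).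
  rewrite mulr_suml -big_split /=; under eq_bigr => s _ do rewrite -mulrDr.
  apply: (avg _ (fun xi => eval_at b y + c xi)) => // xi xib.
  have := CbP xi y xib yb; have := cb xi y xib yb; have := dist0 xi y.
  by rewrite /C; nra.
Qed.

End Evaluation.

(** * Simplicial vertices of chordal graphs *)
Section Chordal.
Context {T : finType}.
Variable e : rel T.
Hypotheses (e_sym : ssrbool.symmetric e) (e_irr : irreflexive e).

Lemma cliqueP (S : {set T}) :
  reflect (forall a b, a \in S -> b \in S -> a != b -> e a b) (clique e S).
Proof.
apply: (iffP forall_inP) => [H a b aS bS ab|H a aS].
  by have /forall_inP/(_ b bS)/implyP/(_ ab) := H a aS.
by apply/forall_inP => b bS; apply/implyP; exact: H.
Qed.

Lemma cliqueS (S S' : {set T}) : S \subset S' -> clique e S' -> clique e S.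
Proof.
move=> SS' /cliqueP H; apply/cliqueP => a b aS bS.
by apply: H; exact: (fintype.subsetP SS').
Qed.

Lemma minimal_path (r : rel T) a b : connect r a b ->
  exists p, [/\ path r a p, last a p = b, uniq (a :: p)
    & forall p', path r a p' -> last a p' = b -> (size p <= size p')%N].
Proof.
move=> /connectP[p0 p0r p0b].
pose P k := [exists t : k.-tuple T, path r a t && (last a t == b)].
have PE p : path r a p -> last a p = b -> P (size p).
  by move=> rp lp; apply/existsP; exists (in_tuple p); rewrite /= rp lp eqxx.
have exP : exists k, P k by exists (size p0); exact: PE.
case: (ex_minnP exP) => k /existsP[t /andP[tr /eqP tb]] kmin.
move: tb; case: (shortenP tr) => p pr pu pt pb; exists p; split=> // p' p'r p'b.
apply: leq_trans (kmin _ (PE _ p'r p'b)); rewrite -(size_tuple t).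
by apply: uniq_leq_size => //; case/andP: pu.
Qed.

(** Joining two neighbours of [v] by a shortest path through vertices that are
    not neighbours of [v] closes a cycle through [v], whose only possible chord
    is the edge between the two neighbours. *)
Lemma neighbours_adjacent v a b (C : {set T}) : chordal e -> e v a -> e v b -> a != b ->
  (forall c, c \in C -> c != v /\ ~~ e v c) ->
  connect [rel x y | [&& e x y, x \in a |: (b |: C) & y \in a |: (b |: C)]] a b ->
  e a b.
Proof.
move=> ech va vb ab Cv; set r := (X in connect X) => rab; apply/negPn/negP => nab.
have rE x y : r x y = [&& e x y, x \in a |: (b |: C) & y \in a |: (b |: C)] by [].
have [p [pr pb pu pmin]] := minimal_path rab.
have pe : path e a p by apply: sub_path pr => x y; rewrite rE => /and3P[].
have sC x : x \in a :: p -> x \in a |: (b |: C).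
  rewrite inE => /predU1P[->|xp]; first by rewrite !inE eqxx.
  suff H q z : path r z q -> x \in q -> x \in a |: (b |: C) by exact: H pr xp.
  elim: q z => // y q IH z /= /andP[rzy yq]; rewrite inE => /predU1P[->|].
    by move: rzy; rewrite rE => /and3P[].
  exact: IH yq.
have va' : v != a by apply: contraTneq va => ->; rewrite e_irr.
have vb' : v != b by apply: contraTneq vb => ->; rewrite e_irr.
have vs : v \notin a :: p.
  apply/negP => /sC; rewrite !inE (negbTE va') (negbTE vb') /= => /Cv[].
  by rewrite eqxx.
have sz : (2 <= size p)%N.
  move: pb pe; case: (p) => [/= E|y [|//] /= -> /andP[E _]]; exfalso.
    by rewrite E eqxx in ab.
  by rewrite E in nab.
(* a chord between two vertices of the path would shorten it *)
have nochord i j : (i.+1 < j)%N -> (j <= size p)%N ->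
    ~~ e (nth v (a :: p) i) (nth v (a :: p) j).
  move=> ij jp; apply/negP => eij.
  have j0 : (0 < j)%N by apply: leq_trans ij.
  have ip : (i <= size p)%N by apply: leq_trans jp; apply: ltnW; apply: ltnW.
  have jp' : (j.-1 < size p)%N by rewrite prednK.
  have lasti : last a (take i p) = nth v (a :: p) i.
    rewrite (last_nth v) size_take_min (minn_idPl ip).
    by case: (i) ip => //= i' ip; rewrite nth_take.
  have dropj : drop j.-1 p = nth v (a :: p) j :: drop j p.
    by rewrite (drop_nth v jp') prednK //; case: (j) j0.
  have := pr; rewrite -{1}(cat_take_drop j.-1 p) cat_path dropj.
  case/andP => _ /= /andP[_ pj].
  have pi : path r a (take i p).
    by have := pr; rewrite -{1}(cat_take_drop i p) cat_path => /andP[].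
  have := pmin (take i p ++ drop j.-1 p).
  rewrite cat_path pi last_cat lasti dropj /= pj andbT /= rE eij.
  rewrite !sC ?mem_nth ?ltnS //=.
  move=> /(_ isT); rewrite size_cat size_take_min (minn_idPl ip) /= size_drop.
  have -> : last (nth v (a :: p) j) (drop j p) = b.
    by have := congr1 (last a) (cat_take_drop j.-1 p); rewrite last_cat dropj /= pb.
  move=> /(_ erefl); rewrite addnS -addSn; apply/negP; rewrite -ltnNge.
  by rewrite -[ltnRHS](subnKC jp) ltn_add2r.
have nextS x : x \in a :: p -> next (v :: a :: p) x = nth v (a :: p) (index x (a :: p)).+1.
  move=> xs; rewrite next_nth inE xs orbT /=.
  by have -> : (v == x) = false by apply: contraNF vs => /eqP ->.
have nextv : next (v :: a :: p) v = a by rewrite next_nth mem_head /= eqxx.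
have nov y : y \in a :: p -> e v y -> y != a -> v != next (v :: a :: p) y -> False.
  move=> ys vy ya; rewrite nextS // => nv.
  have yb : y != b.
    apply: contraNneq nv => ->; rewrite -pb index_last // nth_default //=.
  by have := sC _ ys; rewrite !inE (negbTE ya) (negbTE yb) /= => /Cv[_]; rewrite vy.
have noss x y : x \in a :: p -> y \in a :: p -> e x y ->
    y != next (v :: a :: p) x -> (index x (a :: p) < index y (a :: p))%N -> False.
  move=> xs ys exy; rewrite nextS // => yx ixy.
  have := @nochord (index x (a :: p)) (index y (a :: p)).
  rewrite !nth_index // exy => H; suff : ~~ true by []; apply: H.
    rewrite ltn_neqAle ixy andbT; apply: contraNneq yx => ->.
    by rewrite nth_index.
  by rewrite -ltnS -[(size p).+1]/(size (a :: p)) index_mem.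
have [|||x [y [xc yc exy yx xy]]] := ech (v :: a :: p) _ _ _.
- by rewrite /= vs.
- by rewrite /= !ltnS.
- by rewrite /= va rcons_path pe pb e_sym.
move: xc yc; rewrite (in_cons v _ x) (in_cons v _ y).
case: (eqVneq x v) => [xv _|_ /= xs].
  case: (eqVneq y v) => [yv|_ /= ys]; first by rewrite xv yv e_irr in exy.
  by move: exy yx xy; rewrite xv nextv; exact: nov.
case: (eqVneq y v) => [yv _|_ /= ys].
  by move: exy xy yx; rewrite yv nextv e_sym; exact: nov.
case: (ltngtP (index x (a :: p)) (index y (a :: p))) => [lt|gt|E].
- exact: (noss x y).
- by apply: (noss y x) => //; rewrite e_sym.
- by move: exy; rewrite -(nth_index v xs) E nth_index // e_irr.
Qed.

(** Dirac's theorem. The clique [K] keeps the simplicial vertex found in the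
    smaller graph, made of a component of the non-neighbours of [v] and of the
    clique separating it from [v], away from that separator. *)
Lemma simplicial_vertex (S K : {set T}) : chordal e ->
  K \subset S -> clique e K -> K != S ->
  exists w, [/\ w \in S, w \notin K & clique e [set y in S | e w y]].
Proof.
move=> ech; have [k Sk] := ubnP #|S|.
elim: k => // k IH in S K Sk * => KS Kc KneS.
have pKS : K \proper S by rewrite finset.properEneq KneS.
have [Sc|/cliqueP nSc] := boolP (clique e S).
  case/properP: pKS => _ [w wS wK]; exists w; split=> //.
  by apply: cliqueS Sc; apply/fintype.subsetP => y; rewrite inE => /andP[].
have [v [b [vS bS bv vb Kv]]] : exists v b,
    [/\ v \in S, b \in S, b != v, ~~ e v b
      & forall x, x \in K -> x != v -> e v x].
  have [|nK] := boolP [exists x in K, exists b in S, (b != x) && ~~ e x b].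
    case/exists_inP => v vK /exists_inP[b bS /andP[bv vb]]; exists v, b.
    split=> //; first exact: (fintype.subsetP KS).
    by move=> x xK xv; rewrite e_sym; move/cliqueP: Kc; exact.
  have Kall x y : x \in K -> y \in S -> y != x -> e x y.
    move=> xK yS yx; apply: contraNT nK => nxy; apply/exists_inP; exists x => //.
    by apply/exists_inP; exists y => //; rewrite yx.
  have [a [b [aS bS ab nab]]] : exists a b, [/\ a \in S, b \in S, a != b & ~~ e a b].
    have [/exists_inP[a aS /exists_inP[b bS /andP[ab nab]]]|H] :=
      boolP [exists a in S, exists b in S, (a != b) && ~~ e a b].
      by exists a, b.
    case: nSc => a b aS bS ab; apply: contraNT H => nab.
    by apply/exists_inP; exists a => //; apply/exists_inP; exists b; rewrite ?ab.
  exists a, b; split=> //; first by rewrite eq_sym.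
  by move=> x xK xa; rewrite e_sym; apply: Kall => //; rewrite eq_sym.
pose M := [set y in S | (y != v) && ~~ e v y].
pose r := [rel x y | [&& e x y, x \in M & y \in M]].
have r_sym : connect_sym r.
  by apply: sym_connect_sym => x y /=; rewrite e_sym (andbC (x \in M)).
pose C := [set c in S | connect r b c].
have bM : b \in M by rewrite inE bS bv.
have CM c : c \in C -> c \in M.
  rewrite inE => /andP[_ /connectP[p pr ->]].
  elim: p (b) bM pr => //= y p IHp z zM /andP[/and3P[_ _ yM]]; exact: IHp.
have bC : b \in C by rewrite inE bS connect0.
pose D := [set d in S | e v d && [exists c in C, e d c]].
have DP d : d \in D -> [/\ d \in S, e v d & exists2 c, c \in C & e d c].
  by rewrite inE => /and3P[dS vd /exists_inP].
have Cv c : c \in C -> c != v /\ ~~ e v c.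
  by move/CM; rewrite inE => /and3P[].
have CD c : c \in C -> c \notin D.
  by move=> /Cv[_ nvc]; rewrite inE (negbTE nvc) /= andbF.
have Dc : clique e D.
  apply/cliqueP => a d /DP[aS va [c1 c1C ac1]] /DP[dS vd [c2 c2C dc2]] ad.
  apply: (neighbours_adjacent ech va vd ad Cv).
  set r' := (X in connect X).
  have r'E x y : r' x y = [&& e x y, x \in a |: (d |: C) & y \in a |: (d |: C)] by [].
  have Cin c : c \in C -> c \in a |: (d |: C).
    by move=> cC; rewrite !finset.in_setU cC !orbT.
  apply: (@connect_trans _ _ c1).
    by apply: connect1; rewrite r'E ac1 (Cin _ c1C) finset.in_setU1 eqxx.
  apply: (@connect_trans _ _ c2); last first.
    by apply: connect1; rewrite r'E e_sym dc2 (Cin _ c2C) !finset.in_setU1 eqxx orbT.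
  have : connect r c1 c2.
    move: c1C c2C; rewrite !inE => /andP[_ b1] /andP[_ b2].
    by apply: connect_trans b2; rewrite r_sym.
  case/connectP => p pr ->; elim: p c1 c1C {ac1} pr => //= y p IHp z zC.
  move=> /andP[/and3P[zy zM yM] py].
  have yC : y \in C.
    move: zC (yM); rewrite !inE => /andP[_ bz] /and3P[-> yv vy] /=.
    apply: connect_trans bz _; apply: connect1.
    by rewrite /= zy zM yM.
  apply: (@connect_trans _ _ y); last exact: IHp.
  by apply: connect1; rewrite r'E zy !Cin.
have CDS : C :|: D \subset S.
  by apply/fintype.subsetP => y; rewrite !inE => /orP[] /andP[].
have vCD : v \notin C :|: D.
  by apply/negP; rewrite finset.in_setU => /orP[/Cv[]|/DP[_]]; rewrite ?eqxx ?e_irr.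
have [||w [wCD wD wc]] := IH (C :|: D)%SET D _ (finset.subsetUr _ _) Dc.
- apply: leq_trans (_ : #|S| <= k)%N; last by rewrite -ltnS.
  by apply: proper_card; apply/properP; split=> //; exists v.
- by apply/eqP => E; have := CD b bC; rewrite E finset.in_setU bC.
have wC : w \in C by move: wCD; rewrite finset.in_setU (negbTE wD) orbF.
have [wv nvw] := Cv w wC.
exists w; split; first exact: (fintype.subsetP CDS).
  by apply: contra nvw => wK; apply: Kv.
apply: cliqueS wc; apply/fintype.subsetP => y.
rewrite !finset.in_set => /andP[yS wy]; rewrite wy andbT.
have [vy|nvy] := boolP (e v y).
  apply/orP; right; rewrite yS /=.
  by apply/exists_inP; exists w => //; rewrite e_sym.
apply/orP; left; rewrite yS /=; move: (wC); rewrite inE => /andP[_ bw].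
apply: connect_trans bw _; apply: connect1; rewrite /= wy CM //=.
rewrite inE yS nvy andbT; apply: contraNneq nvw => yv.
by rewrite -yv e_sym.
Qed.

End Chordal.

(** * The sparse Positivstellensatz *)
Section SparseBox.
Context {R : realType} {N : nat}.
Implicit Types (a b f g s : {mpoly R[N]}) (V S C : {set 'I_N}) (y : 'rV[R]_N).
Implicit Types (mm : 'X_{1..N}).
Variable e : rel 'I_N.
Hypotheses (e_sym : ssrbool.symmetric e) (e_irr : irreflexive e) (e_ch : chordal e).

Definition mnm_supp mm : {set 'I_N} := [set i | mm i != 0%N]%SET.

Definition sparse_on S f :=
  forall mm, mm \in msupp f -> clique e (mnm_supp mm) && (mnm_supp mm \subset S).

Lemma msupp_sum_monomials (G : 'X_{1..N} -> Prop) (r : seq 'X_{1..N})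
    (P : pred 'X_{1..N}) (c : 'X_{1..N} -> R) :
  (forall mm, mm \in r -> P mm -> G mm) ->
  forall mm, mm \in msupp (\sum_(m <- r | P m) c m *: 'X_[m]) -> G mm.
Proof.
move=> rG; rewrite big_seq_cond.
elim/big_rec: _ => [mm|m a /andP[mr Pm] aG mm]; first by rewrite -mpolyC0 msupp0.
move/msuppD_le; rewrite mem_cat => /orP[/msuppZ_le|/aG //].
by rewrite msuppX mem_seq1 => /eqP ->; exact: rG.
Qed.

Lemma sparse_onD S a b : sparse_on S a -> sparse_on S b -> sparse_on S (a + b).
Proof. by move=> aS bS mm /msuppD_le; rewrite mem_cat => /orP[/aS|/bS]. Qed.

Lemma polyIn_sparse V S a : clique e V -> V \subset S -> polyIn V a -> sparse_on S a.
Proof.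
move=> Vc VS /polyInP aV mm mma; have mV : mnm_supp mm \subset V.
  by apply/fintype.subsetP => i; rewrite inE; exact: aV.
by rewrite (cliqueS mV Vc) (fintype.subset_trans mV VS).
Qed.

(** [Q] stands for the set of the polynomials that have a certificate; only its
    closure properties matter here, so that no multipliers are tracked. *)
Variable Q : {mpoly R[N]} -> Prop.
Hypothesis Q_add : forall a b, Q a -> Q b -> Q (a + b).
Hypothesis Q_box : forall C a, clique e C -> boxQM C a -> Q a.

(** Induction on the number of variables, eliminating a simplicial vertex. *)
Lemma sparse_putinar_box S f delta : sparse_on S f -> 0 < delta ->
  (forall y, box y -> delta <= eval_at f y) -> Q f.
Proof.
have [k Sk] := ubnP #|S|; elim: k => // k IH in S Sk f delta *.
move=> fS d0 fd; case: (finset.set_0Vmem S) => [S0|[z zS]].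
  apply: (@Q_box finset.set0); first by apply/cliqueP => a b; rewrite inE.
  apply: putinar_box d0 fd; apply/polyInP => mm /fS /andP[_].
  by rewrite S0 => /fintype.subsetP H i mi; apply: H; rewrite inE.
have [|||w [wS _ wc]] := @simplicial_vertex _ e e_sym e_irr S finset.set0 e_ch.
- exact: finset.sub0set.
- by apply/cliqueP => a b; rewrite inE.
- by apply: contraTneq zS => <-; rewrite inE.
pose A := (w |: [set i in S | e w i])%SET.
have Ac : clique e A.
  apply/cliqueP => i j; rewrite !inE => /predU1P[->|/andP[iS wi]].
    by case/predU1P=> [->|/andP[] //]; rewrite eqxx.
  case/predU1P=> [-> _|/andP[jS wj] ij]; first by rewrite e_sym.
  by move/cliqueP: wc; apply; rewrite ?inE ?iS ?jS.
pose a := \sum_(mm <- msupp f | mm w != 0%N) f@_mm *: 'X_[mm].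
pose b := \sum_(mm <- msupp f | ~~ (mm w != 0%N)) f@_mm *: 'X_[mm].
have fE : f = a + b by rewrite [LHS]mpolyE (bigID (fun mm : 'X_{1..N} => mm w != 0%N)) /=.
have aA : polyIn A a.
  apply/polyInP; apply: msupp_sum_monomials => mm /fS /andP[/cliqueP mc mS] mw i mi.
  rewrite !inE; case: (eqVneq i w) => //= iw.
  by rewrite (fintype.subsetP mS) ?mc ?inE // eq_sym.
have bS : sparse_on (S :\ w)%SET b.
  apply: msupp_sum_monomials => mm /fS /andP[mc mS] mw; rewrite mc /=.
  apply/fintype.subsetP => i mi; rewrite !inE (fintype.subsetP mS) // andbT.
  by apply: contraNneq mw => <-; rewrite inE in mi.
have bB : polyIn (S :\ w)%SET b.
  apply/polyInP => mm /bS /andP[_ /fintype.subsetP mS] i mi.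
  by apply: mS; rewrite inE.
have fd' y : box y -> delta <= eval_at (a + b) y by rewrite -fE; exact: fd.
have [phi [phiY aphi bphi]] := separate aA bB d0 fd'.
have d4 : 0 < delta / 4 by lra.
have -> : f = (a - phi) + (b + phi) by rewrite fE; ring.
have phiA := polyInS (finset.subsetIl _ _) phiY.
apply: Q_add.
  apply: (Q_box Ac); apply: putinar_box d4 aphi.
  exact: polyInB.
apply: (IH (S :\ w)%SET _ (b + phi) (delta / 4)) => //.
  by rewrite -ltnS; apply: leq_trans Sk; rewrite ltnS (cardsD1 w S) wS.
apply: sparse_onD => //; apply: polyIn_sparse phiY; last exact: finset.subsetIr.
by apply: cliqueS Ac; exact: finset.subsetIl.
Qed.

Lemma eval_continuous f : continuous (@eval_at R N f).
Proof.
move: f (polyIn_setT f); apply: polyIn_ind => [c|i _|a b _ _ ca cb|a b _ _ ca cb].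
- rewrite (_ : eval_at _ = fun=> c); first exact: cst_continuous.
  by apply/funext => y; rewrite /eval_at mevalC.
- rewrite (_ : eval_at _ = fun y : 'rV[R]_N => y ord0 i); first exact: coord_continuous.
  by apply/funext => y; rewrite /eval_at mevalXU.
- rewrite (_ : eval_at _ = fun y => eval_at a y + eval_at b y).
    by move=> y; apply: cvgD; [exact: (nbhs_filter y)|exact: ca|exact: cb].
  by apply/funext => y; rewrite /eval_at mevalD.
- rewrite (_ : eval_at _ = fun y => eval_at a y * eval_at b y).
    by move=> y; apply: cvgM; [exact: (nbhs_filter y)|exact: ca|exact: cb].
  by apply/funext => y; rewrite /eval_at mevalM.
Qed.

Definition boxed_region (gs : seq {mpoly R[N]}) : set 'rV[R]_N :=
  [set y | box y /\ forall g, g \in gs -> 0 <= eval_at g y].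

Lemma compact_boxed_region gs : compact (boxed_region gs).
Proof.
elim: gs => [|g gs IH].
  rewrite (_ : boxed_region _ = [set y | forall i, `[(-1 : R), 1]%classic (y ord0 i)]).
    by apply: (@rV_compact R N (fun=> `[(-1 : R), 1]%classic)) => i; exact: segment_compact.
  apply/seteqP; split=> y /=; rewrite /boxed_region /=.
    by move=> [yb _] i; rewrite in_itv /= -ler_norml.
  by move=> yb; split=> // i; have := yb i; rewrite in_itv /= -ler_norml.
rewrite (_ : boxed_region _ = boxed_region gs `&` (eval_at g @^-1` [set t | 0 <= t])).
  apply: compact_closedI => //; apply: preimage_closed; last exact: closed_ge.
  by move=> y _; exact: eval_continuous.
apply/seteqP; split=> y /=; rewrite /boxed_region /=.
  move=> [yb yg]; split; last by apply: yg; rewrite mem_head.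
  by split=> // h hs; apply: yg; rewrite inE hs orbT.
by move=> [[yb yg] g0]; split=> // h; rewrite inE => /predU1P[->|/yg].
Qed.

Lemma compact_pos_lower (K : set 'rV[R]_N) (h : 'rV[R]_N -> R) :
  compact K -> continuous h -> (forall y, K y -> 0 < h y) ->
  exists2 mu, 0 < mu & forall y, K y -> mu <= h y.
Proof.
move=> cK ch hpos; have [[y0 Ky0]|K0] := pselect (exists y, K y); last first.
  by exists 1 => // y Ky; case: K0; exists y.
have [|c cK' cmin] := @EVT_min_rV _ _ h K (ex_intro _ y0 Ky0) cK.
  exact: continuous_subspaceT.
exists (h c) => [|y Ky]; first by apply: hpos; move: cK'; rewrite inE.
by apply: cmin; rewrite inE.
Qed.

Lemma bernoulli (t : R) k : 0 <= t -> 1 + k%:R * t <= (1 + t) ^+ k.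
Proof.
move=> t0; elim: k => [|k IH]; first by rewrite mul0r addr0 expr0.
rewrite exprS; apply: le_trans (ler_wpM2l _ IH); last by lra.
rewrite -natr1; have : 0 <= k%:R * t * t by rewrite !mulr_ge0.
by lra.
Qed.

(** With t = g / T in [-1, 1], the subtracted term is t * (1 - t) ^ n. By
    compactness, at each point f >= mu or t <= - mu for a fixed mu > 0. In the
    first case the term is at most 1 / n < mu: it is negative for t < 0, and for
    t >= 0 one has n * t * (1 - t) ^ n <= (1 + t) ^ n * (1 - t) ^ n <= 1. In
    the second case it is at most - n * mu ^ 2 by Bernoulli's inequality,
    which outweighs any lower bound of f. *)
Lemma penalty (K : set 'rV[R]_N) V f g : compact K -> (forall y, K y -> box y) ->
  polyIn V g -> (forall y, K y -> 0 <= eval_at g y -> 0 < eval_at f y) ->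
  exists2 s, polyIn V s & forall y, K y -> 0 < eval_at (f - s ^+ 2 * g) y.
Proof.
move=> cK Kb gV fg; have [D D0 gD] := eval_bounded g.
have [B B0 fB] := eval_bounded f; pose D1 := D + 1.
have D10 : 0 < D1 by rewrite /D1; lra.
pose th := (D1 ^- 2)%:MP * g; pose t y := eval_at th y.
have tE y : t y = eval_at g y / D1 ^+ 2 by rewrite /t /eval_at mevalM mevalC mulrC.
have tN y : eval_at (- th) y = - t y by rewrite /t /eval_at mevalN.
have t1 y : K y -> `|t y| <= 1.
  move=> /Kb/gD Dy; rewrite tE normrM normfV (ger0_norm (sqr_ge0 _)).
  rewrite ler_pdivrMr ?exprn_gt0 // mul1r (le_trans Dy) // /D1.
  by nra.
have [mu mu0 hmu] : exists2 mu, 0 < mu & forall y, K y ->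
    mu <= Num.max (eval_at f y) (eval_at (- th) y).
  apply: (compact_pos_lower (h := eval_at f \max eval_at (- th))) => //.
    by move=> y; apply: continuous_max; exact: eval_continuous.
  move=> y Ky; rewrite /= tN tE lt_max; case: (lerP 0 (eval_at g y)) => gy.
    by rewrite (fg _ Ky gy).
  by rewrite oppr_gt0 pmulr_llt0 ?invr_gt0 ?exprn_gt0 // gy orbT.
pose k := Num.bound (1 / mu + B / mu ^+ 2).
have kb : 1 / mu + B / mu ^+ 2 < k%:R.
  by apply: archi_boundP; rewrite addr_ge0 // divr_ge0 // ?sqr_ge0 // ltW.
have b1 : 0 <= 1 / mu by rewrite divr_ge0 // ltW.
have b2 : 0 <= B / mu ^+ 2 by rewrite divr_ge0 // sqr_ge0.
have k1 : 1 < k%:R * mu by rewrite -ltr_pdivrMr //; lra.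
have k2 : B < k%:R * mu * mu by rewrite -mulrA -expr2 -ltr_pdivrMr ?exprn_gt0 //; lra.
have kk : (k%:R : R) <= (k * 2)%:R by rewrite ler_nat leq_pmulr.
pose s := D1^-1%:MP * (1 - th) ^+ k.
exists s => [|y Ky].
  apply: polyInM; [exact: polyInC|apply: polyInXn; apply: polyInB].
    exact: polyIn1.
  by apply: polyInM; [exact: polyInC|].
have -> : eval_at (f - s ^+ 2 * g) y = eval_at f y - (1 - t y) ^+ (k * 2) * t y.
  rewrite /eval_at mevalB mevalM rmorphXn /= /s mevalM mevalC rmorphXn /=.
  rewrite mevalB meval1 -/(eval_at th y) -/(t y) tE -!/(eval_at _ _) exprMn -exprM.
  by rewrite exprVn; ring.
have n1 : 1 < (k * 2)%:R * mu by apply: lt_le_trans k1 _; rewrite ler_pM2r.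
have n2 : B < (k * 2)%:R * mu * mu.
  by apply: lt_le_trans k2 _; rewrite !ler_pM2r.
set n := (k * 2)%N in n1 n2 *; have {}t1 := t1 y Ky; have := hmu y Ky.
have := fB _ (Kb _ Ky); rewrite !ler_norml in t1 * => /andP[fB' _].
case/andP: t1 => tm tp; rewrite tN le_max => /orP[fmu|tmu].
- case: (lerP 0 (t y)) => [t0|t0]; last first.
    have : (1 - t y) ^+ n * t y <= 0.
      by rewrite mulr_ge0_le0 ?exprn_ge0 ?ltW //; lra.
    by lra.
  have n0 : 0 < n%:R :> R.
    by rewrite -(pmulr_lgt0 _ mu0); apply: lt_trans n1.
  suff : (1 - t y) ^+ n * t y < mu by lra.
  rewrite -(ltr_pM2l n0); apply: le_lt_trans n1.
  apply: (@le_trans _ _ ((1 - t y) ^+ n * (1 + t y) ^+ n)).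
    rewrite mulrCA; apply: ler_wpM2l; first by rewrite exprn_ge0; lra.
    by apply: le_trans (bernoulli n t0); lra.
  rewrite -exprMn; apply: exprn_ile1; first by apply: mulr_ge0; lra.
  by have := sqr_ge0 (t y); rewrite expr2; lra.
- have P : n%:R * mu <= (1 - t y) ^+ n.
    apply: (@le_trans _ _ (1 + n%:R * (- t y))); last by apply: bernoulli; lra.
    have : n%:R * mu <= n%:R * (- t y) by apply: ler_wpM2l.
    by lra.
  have : n%:R * mu * mu <= (1 - t y) ^+ n * (- t y).
    by apply: ler_pM => //; rewrite ?mulr_ge0 // ltW.
  by rewrite mulrN; lra.
Qed.

Theorem sparse_putinar (gs : seq {mpoly R[N]}) f :
  (forall g, g \in gs -> exists V, [/\ clique e V, polyIn V g
     & forall s, polyIn V s -> Q (s ^+ 2 * g)]) ->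
  sparse_on [set: 'I_N] f ->
  (forall y, boxed_region gs y -> 0 < eval_at f y) -> Q f.
Proof.
elim: gs => [|g gs IH] in f * => Qgs fS fpos.
  have [mu mu0 fmu] := compact_pos_lower (@compact_boxed_region [::])
    (@eval_continuous f) fpos.
  by apply: sparse_putinar_box fS mu0 _ => y yb; apply: fmu; split.
have [V [Vc gV QV]] := Qgs g (mem_head _ _).
have [||s sV spos] := @penalty (boxed_region gs) V f g (@compact_boxed_region gs) _ gV.
- by move=> y [].
- move=> y [yb ygs] yg; apply: fpos; split=> // h.
  by rewrite inE => /predU1P[->|/ygs].
rewrite -(subrK (s ^+ 2 * g) f); apply: Q_add; last exact: QV.
apply: IH => //; first by move=> h hgs; apply: Qgs; rewrite inE hgs orbT.
apply: sparse_onD => //; apply: polyIn_sparse Vc (finset.subsetT _) _.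
by apply: polyInN; apply: polyInM => //; exact: polyInXn.
Qed.

End SparseBox.

(** * Homogenization and the reformulation *)
Section QuadraticModules.
Context {R : realType} {N : nat}.
Implicit Types (a b s : {mpoly R[N]}) (V : {set 'I_N}) (G : seq {mpoly R[N]}).

Lemma sosD V a b : sos V a -> sos V b -> sos V (a + b).
Proof.
move=> [r [rV ->]] [r' [rV' ->]]; exists (r ++ r'); rewrite big_cat; split=> // t.
by rewrite mem_cat => /orP[/rV|/rV'].
Qed.

Lemma sos_sqr V s : polyIn V s -> sos V (s ^+ 2).
Proof.
move=> sV; exists [:: s]; rewrite big_seq1; split=> // t.
by rewrite mem_seq1 => /eqP ->.
Qed.

Lemma sos0 V : sos V (0 : {mpoly R[N]}).
Proof. by exists [::]; rewrite big_nil; split. Qed.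

Lemma QM_add G V a b : QM G V a -> QM G V b -> QM G V (a + b).
Proof.
move=> [a0 [s [a0V sV ->]]] [b0 [t [b0V tV ->]]].
exists (a0 + b0), (fun h => s h + t h); split; first exact: sosD.
  by move=> h hG; apply: sosD; [exact: sV|exact: tV].
under [in RHS]eq_bigr => h _ do rewrite mulrDr.
by rewrite big_split /=; ring.
Qed.

Lemma QM_sqr G V s : polyIn V s -> QM G V (s ^+ 2).
Proof.
move=> sV; exists (s ^+ 2), (fun=> 0); split; first exact: sos_sqr.
  by move=> h _; exact: sos0.
by rewrite big1 ?addr0 // => h _; rewrite mulr0.
Qed.

Lemma QM0 G V : QM G V 0.
Proof. by have := QM_sqr G (polyIn0 V); rewrite expr0n. Qed.

Lemma QM_generator G V h s : h \in G -> polyIn V s -> QM G V (s ^+ 2 * h).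
Proof.
move=> hG sV; set c : R := (count_mem h G)%:R.
have c0 : 0 < c by rewrite ltr0n -has_count has_pred1.
(* [G] is a list: the multiplier is shared between the repetitions of [h]. *)
pose r := (Num.sqrt c^-1)%:MP * s.
have rE : c%:MP * r ^+ 2 = s ^+ 2.
  rewrite /r exprMn -rmorphXn /= sqr_sqrtr ?invr_ge0 ?ltW // mulrA -mpolyCM.
  by rewrite divff ?gt_eqF // mpolyC1 mul1r.
exists 0, (fun h' => if h' == h then r ^+ 2 else 0); split; first exact: sos0.
  move=> h' _; case: eqP => _; last exact: sos0.
  by apply: sos_sqr; apply: polyInM => //; exact: polyInC.
rewrite add0r (bigID (pred1 h)) /= [X in _ + X]big1 ?addr0; last first.
  by move=> h' /negbTE ->; rewrite mulr0.
rewrite (eq_bigr (fun=> h * r ^+ 2)) => [|h' /eqP ->]; last by rewrite eqxx.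
by rewrite big_const_seq iter_addr_0 -mulr_natr -mpolyC_nat -rE mulrC mulrA mulrAC.
Qed.

Lemma boxQM_QM G V a : (forall i, i \in V -> 1 - 'X_i ^+ 2 \in G) ->
  boxQM V a -> QM G V a.
Proof.
move=> VG; elim=> {a} [r rV|i r iV rV|a b _ aV _ bV]; last exact: QM_add.
  exact: QM_sqr.
by rewrite mulrC; apply: QM_generator => //; exact: VG.
Qed.

End QuadraticModules.

Section Homogenization.
Context {R : realType} {n : nat}.
Implicit Types (q : {mpoly R[n]}) (y : 'rV[R]_n.+1).

Lemma eval_homogenize q y : eval_at (homogenize q) y =
  \sum_(mm <- msupp q) q@_mm *
    (y ord0 ord0 ^+ (mdegree q - mdeg mm) * \prod_i y ord0 (lift ord0 i) ^+ mm i).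
Proof.
rewrite /eval_at /homogenize raddf_sum; apply: eq_bigr => mm _ /=.
rewrite mevalZ mevalX big_ord_recl mnmE unlift_none; congr (_ * (_ * _)).
by apply: eq_bigr => i _; rewrite mnmE liftK.
Qed.

Lemma eval_homogenize_affine q y : y ord0 ord0 != 0 ->
  eval_at (homogenize q) y = y ord0 ord0 ^+ mdegree q *
    eval_at q (\row_i (y ord0 (lift ord0 i) / y ord0 ord0)).
Proof.
set t := y ord0 ord0 => t0; rewrite eval_homogenize /eval_at mevalE mulr_sumr.
rewrite big_seq [RHS]big_seq; apply: eq_bigr => mm mmq.
rewrite [RHS]mulrCA; congr (_ * _).
under [in RHS]eq_bigr => i _ do rewrite mxE expr_div_n.
rewrite prodf_div prodrXr -mdegE [RHS]mulrCA [LHS]mulrC; congr (_ * _).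
have le : (mdeg mm <= mdegree q)%N.
  by have := msize_mdeg_lt mmq; rewrite /mdegree; case: (msize q).
by rewrite -[in RHS](subnK le) exprD mulfK // expf_neq0.
Qed.

(** At x_0 = 0 only the monomials of maximal degree survive, thanks to
    0 ^ 0 = 1. *)
Lemma eval_homogenize_infinity q y : y ord0 ord0 = 0 ->
  eval_at (homogenize q) y = eval_at (top_part q) (\row_i y ord0 (lift ord0 i)).
Proof.
move=> y0; rewrite eval_homogenize /eval_at /top_part pihomogE raddf_sum /=.
rewrite [RHS]big_mkcond /= big_seq [RHS]big_seq; apply: eq_bigr => mm mmq.
have le : (mdeg mm <= mdegree q)%N.
  by have := msize_mdeg_lt mmq; rewrite /mdegree; case: (msize q).
rewrite y0 expr0n subn_eq0 eqn_leq le /=; case: ifP => _; last by rewrite mul0r mulr0.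
rewrite mul1r mevalZ mevalX; congr (_ * _).
by apply: eq_bigr => i _; rewrite mxE.
Qed.

Lemma eval_tilde p q (z : 'rV[R]_(n.+1 + p)) :
  eval_at (tilde p q) z = eval_at (homogenize q) (\row_i z ord0 (lshift p i)).
Proof.
rewrite /eval_at /tilde comp_mpoly_meval; apply: meval_eq => i.
by rewrite tnth_mktuple mevalXU mxE.
Qed.

End Homogenization.

Section Reformulation.
Context {R : realType} {n m p : nat}.
Variables (f : {mpoly R[n]}) (g : 'I_m -> {mpoly R[n]}) (x : 'I_p -> {set 'I_n}).

(** In the sum of the h'_l each x_i ^ 2 is counted [multiplicity] times with
    the inverse weight, and x_0 ^ 2 is counted p times with weight 1 / p. Hence
    |x~| ^ 2 + |w| ^ 2 = p, whereas the last equation says |w| ^ 2 = p - 1. If p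
    were 0, the last equation would read 1 = 0. *)
Lemma reformulation_sphere (z : 'rV[R]_(n.+1 + p)) :
  (\bigcup_(l < p) x l = [set: 'I_n])%SET ->
  (forall j, eval_at (hprime R x j) z = 0) ->
  \sum_i z ord0 (lshift p i) ^+ 2 = 1.
Proof.
move=> xU hz; pose t := z ord0 (lshift p ord0).
pose X i := z ord0 (lshift p (lift ord0 i)); pose W l := z ord0 (rshift n.+1 l).
have last0 : \sum_(l < p) W l ^+ 2 = p%:R - 1.
  have := hz ord_max; rewrite /hprime unlift_none /eval_at mevalD mevalB meval1.
  rewrite -mpolyC_nat mevalC raddf_sum /=.
  under eq_bigr => l _ do rewrite rmorphXn /= mevalXU.
  move=> E; apply/eqP; rewrite -subr_eq0 -[X in _ == X]E; apply/eqP.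
  by rewrite /W; ring.
have hl l : \sum_(i in x l) (multiplicity x i)%:R^-1 * X i ^+ 2
    + p%:R^-1 * t ^+ 2 + W l ^+ 2 - 1 = 0.
  have := hz (lift ord_max l); rewrite /hprime liftK /eval_at.
  rewrite mevalB meval1 !mevalD mevalZ !rmorphXn /= !mevalXU raddf_sum /=.
  by under eq_bigr => i _ do rewrite mevalZ rmorphXn /= mevalXU.
have p0 : (0 < p)%N.
  case: (posnP p) => // p0; exfalso; move: last0; rewrite big1 => [/eqP|l _].
    by rewrite p0 sub0r eq_sym oppr_eq0 oner_eq0.
  by have := ltn_ord l; rewrite {2}p0.
have multE : \sum_(l < p) \sum_(i in x l) (multiplicity x i)%:R^-1 * X i ^+ 2 =
    \sum_i X i ^+ 2.
  rewrite (exchange_big_dep predT) //=; apply: eq_bigr => i _.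
  rewrite (eq_bigl (fun l => l \in [set l | i \in x l]%SET)); last first.
    by move=> l; rewrite inE.
  rewrite sumr_const -/(multiplicity x i) -mulrnAl -mulr_natr mulVf ?mul1r //.
  rewrite pnatr_eq0 -lt0n; apply/card_gt0P.
  have : i \in (\bigcup_(l < p) x l)%SET by rewrite xU inE.
  by case/bigcupP=> l _ il; exists l; rewrite inE.
have tE : \sum_(l < p) p%:R^-1 * t ^+ 2 = t ^+ 2.
  rewrite sumr_const card_ord -mulrnAl -mulr_natr mulVf ?mul1r //.
  by rewrite pnatr_eq0 -lt0n.
have : \sum_(l < p) (\sum_(i in x l) (multiplicity x i)%:R^-1 * X i ^+ 2
    + p%:R^-1 * t ^+ 2 + W l ^+ 2 - 1) = 0 by apply: big1 => l _; exact: hl.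
rewrite sumrB !big_split /= multE tE last0 sumr_const card_ord.
by rewrite big_ord_recl -/t -/(X _) => E; rewrite /X /t in E *; lra.
Qed.

Lemma tilde_pos (z : 'rV[R]_(n.+1 + p)) :
  (\bigcup_(l < p) x l = [set: 'I_n])%SET ->
  (forall y, feasible g y -> 0 < eval_at f y) ->
  positive_at_infinity f g ->
  0 <= z ord0 (lshift p ord0) ->
  (forall j, 0 <= eval_at (tilde p (g j)) z) ->
  (forall j, eval_at (hprime R x j) z = 0) ->
  0 < eval_at (tilde p f) z.
Proof.
move=> xU fpos finf t0 gz hz; have := reformulation_sphere xU hz.
rewrite big_ord_recl eval_tilde; set y := \row_i z ord0 (lshift p i) => sph.
have yE i : y ord0 i = z ord0 (lshift p i) by rewrite mxE.
rewrite -!yE in t0 sph.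
have gy j : 0 <= eval_at (homogenize (g j)) y by rewrite -eval_tilde.
move: t0; rewrite le_eqVlt => /orP[/eqP y0|y0].
  rewrite eval_homogenize_infinity //; apply: finf; split=> [j|].
    by rewrite -eval_homogenize_infinity.
  move: sph; rewrite -y0 expr0n add0r => <-; apply: eq_bigr => i _.
  by rewrite mxE yE.
have y0' : y ord0 ord0 != 0 by rewrite gt_eqF.
rewrite eval_homogenize_affine //; apply: mulr_gt0; first exact: exprn_gt0.
apply: fpos => j; have := gy j; rewrite eval_homogenize_affine //.
by rewrite pmulr_rge0 // exprn_gt0.
Qed.

End Reformulation.

Lemma clique_in_maximal (T : finType) (e : rel T) q (u : 'I_q -> {set T}) C :
  maximal_cliques e u -> clique e C -> exists l, C \subset u l.
Proof.
move=> [_ uP] Cc; have [M Mmax CM] := maxset_exists Cc.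
by have [l lM] := (uP M).1 Mmax; exists l; rewrite lM.
Qed.

Theorem theorem4p5 (R : realType) (n m p q : nat)
    (f : {mpoly R[n]}) (g : 'I_m -> {mpoly R[n]}) (x : 'I_p -> {set 'I_n})
    (e : rel 'I_(n.+1 + p)) (u : 'I_q -> {set 'I_(n.+1 + p)})
    (J : 'I_q -> {set 'I_m}) (I : 'I_q -> {set 'I_p.+1})
    (f_bounded :
       (-oo < ereal_inf [set (eval_at f y)%:E | y in feasible g])%E)
    (sparsity : correlative_sparsity f g x)
    (e_extension : chordal_extension (csp_adj f g x) e)
    (u_cliques : maximal_cliques e u)
    (J_partition : family_partition J)
    (J_vars : forall l j, j \in J l -> polyIn (u l) (tilde p (g j)))
    (I_partition : family_partition I)
    (I_vars : forall l j, j \in I l -> polyIn (u l) (hprime R x j))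
    (K_closed : closed_at_infinity g)
    (f_pos : forall y, feasible g y -> 0 < eval_at f y)
    (f_pos_inf : positive_at_infinity f g) :
  exists (sigma : 'I_q -> {mpoly R[n.+1 + p]})
         (tau : 'I_q -> 'I_p.+1 -> {mpoly R[n.+1 + p]}),
    [/\ forall l, QM (clique_generators g (u l) (J l)) (u l) (sigma l),
        forall l j, j \in I l -> polyIn (u l) (tau l j)
      & tilde p f =
          \sum_(l < q) (sigma l + \sum_(j in I l) tau l j * hprime R x j)].
Proof.
have [[e_sym e_irr] e_ch e_adj] := e_extension.
have [xU _ _] := sparsity.
pose Q a := exists (sigma : 'I_q -> {mpoly R[n.+1 + p]})
         (tau : 'I_q -> 'I_p.+1 -> {mpoly R[n.+1 + p]}),
    [/\ forall l, QM (clique_generators g (u l) (J l)) (u l) (sigma l),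
        forall l j, j \in I l -> polyIn (u l) (tau l j)
      & a = \sum_(l < q) (sigma l + \sum_(j in I l) tau l j * hprime R x j)].
have Q_add a b : Q a -> Q b -> Q (a + b).
  move=> [s [t [sQ tu ->]]] [s' [t' [sQ' tu' ->]]].
  exists (fun l => s l + s' l), (fun l j => t l j + t' l j); split.
  - by move=> l; exact: QM_add.
  - by move=> l j jl; apply: polyInD; [exact: tu|exact: tu'].
  rewrite -big_split; apply: eq_bigr => l _ /=.
  under [in RHS]eq_bigr => j _ do rewrite mulrDl.
  by rewrite big_split /=; ring.
have Q_QM l a : QM (clique_generators g (u l) (J l)) (u l) a -> Q a.
  move=> aQ; exists (fun k => if k == l then a else 0), (fun _ _ => 0); split.
  - by move=> k; case: eqP => [->|_] //; exact: QM0.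
  - by move=> *; exact: polyIn0.
  rewrite (bigD1 l) //= eqxx [X in _ + X]big1 ?addr0 => [|k kl].
    by rewrite big1 ?addr0 // => j _; rewrite mul0r.
  by rewrite (negbTE kl) big1 ?addr0 // => j _; rewrite mul0r.
have Q_h l j t : j \in I l -> polyIn (u l) t -> Q (t * hprime R x j).
  move=> jl tu; exists (fun=> 0), (fun k i => if (k == l) && (i == j) then t else 0).
  split=> [k|k i ik|]; first exact: QM0.
    by case: andP => [[/eqP -> _]|_] //; exact: polyIn0.
  rewrite (bigD1 l) //= [X in _ + X]big1 ?addr0 => [|k kl].
    rewrite add0r (bigD1 j) //= !eqxx big1 ?addr0 // => i /andP[_ /negbTE ->].
    by rewrite andbF mul0r.
  by rewrite add0r big1 // => i _; rewrite (negbTE kl) mul0r.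
have Q_box C a : clique e C -> boxQM C a -> Q a.
  move=> Cc aC; have [l Cl] := clique_in_maximal u_cliques Cc.
  apply: (Q_QM l); apply: boxQM_QM (boxQMS Cl aC) => i iu.
  rewrite inE mem_cat; apply/orP; right; apply/orP; left.
  by apply/mapP; exists i; rewrite // mem_enum.
have u_clique l : clique e (u l).
  by have /maxsetP[] : maxset (clique e) (u l) by apply/u_cliques.2; exists l.
pose gs : seq {mpoly R[n.+1 + p]} := x0_var :: [seq tilde p (g j) | j <- enum 'I_m]
    ++ [seq hprime R x j | j <- enum 'I_p.+1]
    ++ [seq - hprime R x j | j <- enum 'I_p.+1].
apply: (sparse_putinar e_sym e_irr e_ch Q_add Q_box (gs := gs)) => [h||z [zb zg]].
(* Each constraint is attached to one maximal clique that contains its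
   variables: any clique containing x_0 for x_0 >= 0, and the clique prescribed
   by the partitions for the other ones. *)
- rewrite inE => /orP[/eqP ->|]; last rewrite !mem_cat => /or3P[]/mapP[j _ ->].
  + have [|l zl] := @clique_in_maximal _ e _ u [set lshift p ord0]%SET u_cliques.
      by apply/cliqueP => a b; rewrite !inE => /eqP -> /eqP ->; rewrite eqxx.
    exists (u l); split=> // [|s su].
      by apply: polyInX; apply: (fintype.subsetP zl); rewrite inE.
    by apply: (Q_QM l); apply: QM_generator => //; rewrite mem_head.
  + have : j \in (\bigcup_(l < q) J l)%SET by rewrite J_partition.1 inE.
    case/bigcupP=> l _ jl; exists (u l); split=> // [|s su]; first exact: J_vars.
    apply: (Q_QM l); apply: QM_generator => //.
    by rewrite in_cons mem_cat (map_f (fun j => tilde p (g j))) ?orbT ?mem_enum.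
  + have : j \in (\bigcup_(l < q) I l)%SET by rewrite I_partition.1 inE.
    case/bigcupP=> l _ jl; exists (u l); split=> // [|s su]; first exact: I_vars.
    by apply: (Q_h l) => //; exact: polyInXn.
  + have : j \in (\bigcup_(l < q) I l)%SET by rewrite I_partition.1 inE.
    case/bigcupP=> l _ jl; exists (u l); split=> // [|s su].
      by apply: polyInN; exact: I_vars.
    by rewrite mulrN -mulNr; apply: (Q_h l) => //; apply: polyInN; exact: polyInXn.
(* The variables of a monomial of tilde f are pairwise adjacent: take gamma = 0
   in the definition of the csp graph. *)
- move=> mm mmf; rewrite finset.subsetT andbT; apply/cliqueP => a b.
  rewrite !inE => ma mb ab; apply: e_adj; split=> //; left; exists 0, mm.
    by rewrite scale0r subr0.
  by rewrite ma mb.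
apply: (tilde_pos xU f_pos f_pos_inf) => [|j|j].
- by have := zg x0_var (mem_head _ _); rewrite /eval_at mevalXU.
- by apply: zg; rewrite in_cons !mem_cat (map_f (fun j => tilde p (g j))) ?orbT ?mem_enum.
apply: le_anti; apply/andP; split.
  have : 0 <= eval_at (- hprime R x j) z.
    apply: zg; rewrite in_cons !mem_cat (map_f (fun j => - hprime R x j)) ?orbT //.
    by rewrite mem_enum.
  by rewrite /eval_at mevalN oppr_ge0.
apply: zg; rewrite in_cons !mem_cat (map_f (hprime R x)) ?orbT //.
by rewrite mem_enum.
Qed.
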